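(* Consider the one-dimensional case $n=1$. Let $m\ge1$ and let $\{(p_i,\theta_i,\gamma_i)\}_{i=1}^m\subset\mathbb{R}\times\mathbb{R}\times\mathbb{R}$ satisfy assumptions (A1), (A2), (A3) stated in the context. Let $f(x,t)=\max_{i\in\{1,\dots,m\}}\{p_ix-t\theta_i-\gamma_i\}$ for $x\in\mathbb{R}$, $t\ge0$, and let $u=\nabla_xf$ be the function $$u(x,t)=p_j,\quad\text{where } j\in\operatorname*{arg\,max}_{i\in\{1,\dots,m\}}\{p_ix-t\theta_i-\gamma_i\}$$ (when there is more than one maximizer, any maximizer $j$ may be chosen). Let $J$ and $H$ be the functions defined in the context, and let $\tilde H:\mathbb{R}\to\mathbb{R}$ be a locally Lipschitz continuous function. Then the following two statements hold. (i) The function $u$ is the entropy solution to the conservation law $$\begin{cases}\dfrac{\partial u}{\partial t}(x,t)+\nabla_xH(u(x,t))=0 & \text{in }\mathbb{R}\times(0,+\infty),\\ u(x,0)=\nabla J(x) & \text{in }\mathbb{R}.\end{cases}$$ (ii) The function $u$ is the entropy solution to the conservation law $$\begin{cases}\dfrac{\partial u}{\partial t}(x,t)+\nabla_x\tilde H(u(x,t))=0 & \text{in }\mathbb{R}\times(0,+\infty),\\ u(x,0)=\nabla J(x) & \text{in }\mathbb{R},\end{cases}$$ if and only if there exists a constant $C\in\mathbb{R}$ such that $\tilde H(p_i)=H(p_i)+C$ for every $i\in\{1,\dots,m\}$ and $\tilde H(p)\ge H(p)+C$ for any $p\in\operatorname{conv}\{p_1,\dots,p_m\}$.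
   Context: Notation: $\Lambda_m=\{(\alpha_1,\dots,\alpha_m)\in[0,1]^m:\sum_{i=1}^m\alpha_i=1\}$ is the unit simplex; $\operatorname{dom}\varphi=\{x:\varphi(x)<+\infty\}$; $\varphi^*(p)=\sup_{x\in\mathbb{R}}\{px-\varphi(x)\}$ is the Fenchel--Legendre transform. The symbols $\nabla$ and $\nabla_x$ denote derivatives (with respect to $x$) in the sense of distributions when the classical derivatives do not exist. Assumptions on the parameters: (A1) $p_i\ne p_j$ whenever $i\ne j$. (A2) There exists a convex function $g:\mathbb{R}\to\mathbb{R}$ such that $g(p_i)=\gamma_i$ for every $i$. (A3) For any $j\in\{1,\dots,m\}$ and any $(\alpha_1,\dots,\alpha_m)\in\Lambda_m$ with $\alpha_j=0$, $\sum_{i\ne j}\alpha_ip_i=p_j$ and $\sum_{i\ne j}\alpha_i\gamma_i=\gamma_j$, there holds $\sum_{i\ne j}\alpha_i\theta_i>\theta_j$. Definition of $J$: $J(x)=\max_{i\in\{1,\dots,m\}}\{p_ix-\gamma_i\}$ for $x\in\mathbb{R}$. One has $\operatorname{dom}J^*=\operatorname{conv}\{p_1,\dots,p_m\}$. Definition of $\mathcal{A}(p)$ and $H$: for $p\in\operatorname{dom}J^*$, $\mathcal{A}(p)$ is the set of minimizers of $\sum_{i=1}^m\alpha_i\gamma_i$ over all $(\alpha_1,\dots,\alpha_m)\in\Lambda_m$ with $\sum_{i=1}^m\alpha_ip_i=p$. The function $H:\mathbb{R}\to\mathbb{R}\cup\{+\infty\}$ is $H(p)=\inf_{\alpha\in\mathcal{A}(p)}\sum_{i=1}^m\alpha_i\theta_i$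 if $p\in\operatorname{dom}J^*$, and $H(p)=+\infty$ otherwise. ''Entropy solution'' is the standard (Kruzhkov) notion of bounded entropy solution of a scalar conservation law with locally Lipschitz flux, functions being identified when they agree almost everywhere. In (i), since $u$ takes values in $\operatorname{dom}J^*$ and $H$ is Lipschitz continuous on $\operatorname{dom}J^*$, the flux is understood as any Lipschitz extension to $\mathbb{R}$ of the restriction of $H$ to $\operatorname{dom}J^*$. *)

(* Defs.v *)
From HB Require Import structures.
From mathcomp Require Import all_boot all_order all_algebra.
From mathcomp Require Import all_classical all_reals all_analysis.

Set Implicit Arguments.
Unset Strict Implicit.
Unset Printing Implicit Defensive.

Import Order.TTheory GRing.Theory Num.Theory.
Import numFieldNormedType.Exports.

Local Open Scope classical_set_scope.
Local Open Scope ring_scope.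

(* A parameter family with m >= 1 members is indexed by 'I_m'.+1, m = m'.+1. *)

Definition fmax (R : realType) (m : nat) (a : 'I_m.+1 -> R) : R :=
  \big[Num.max/a ord0]_(i < m.+1) a i.

Definition simplex (R : realType) (m : nat) : set ('I_m -> R) :=
  [set a | (forall i, 0 <= a i <= 1) /\ \sum_(i < m) a i = 1].

Definition conv_hull (R : realType) (m : nat) (p : 'I_m -> R) : set R :=
  [set q | exists2 a, simplex a & \sum_(i < m) a i * p i = q].

Definition dom (R : realType) (phi : R -> \bar R) : set R :=
  [set x | (phi x < +oo)%E].

Definition fenchel (R : realType) (phi : R -> \bar R) (q : R) : \bar R :=
  ereal_sup [set ((q * x)%:E - phi x)%E | x in [set: R]].

Definition assumptionA1 (R : realType) (m : nat) (p : 'I_m -> R) : Prop :=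
  forall i j, i != j -> p i != p j.

Definition assumptionA2 (R : realType) (m : nat) (p gamma : 'I_m -> R) : Prop :=
  exists g : R -> R,
    @convex_function R R^o [set: R] g /\ forall i, g (p i) = gamma i.

Definition assumptionA3 (R : realType) (m : nat)
    (p theta gamma : 'I_m -> R) : Prop :=
  forall (j : 'I_m) (a : 'I_m -> R), simplex a -> a j = 0 ->
    \sum_(i < m | i != j) a i * p i = p j ->
    \sum_(i < m | i != j) a i * gamma i = gamma j ->
    theta j < \sum_(i < m | i != j) a i * theta i.

(* The initial value of the conservation law, the gradient of J, is taken to be
   the classical derivative of J: it exists off the finitely many kinks, and
   agrees a.e. with the distributional derivative. *)
Definition J (R : realType) (m : nat) (p gamma : 'I_m.+1 -> R) (x : R) : R :=
  fmax (fun i => p i * x - gamma i).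

Definition f (R : realType) (m : nat) (p theta gamma : 'I_m.+1 -> R)
    (x t : R) : R :=
  fmax (fun i => p i * x - t * theta i - gamma i).

Definition domJstar (R : realType) (m : nat) (p gamma : 'I_m.+1 -> R) : set R :=
  dom (fenchel (fun x => (J p gamma x)%:E)).

Definition minimizers (R : realType) (m : nat) (p gamma : 'I_m -> R) (q : R) :
    set ('I_m -> R) :=
  [set a | [/\ simplex a, \sum_(i < m) a i * p i = q &
    forall b, simplex b -> \sum_(i < m) b i * p i = q ->
      \sum_(i < m) a i * gamma i <= \sum_(i < m) b i * gamma i]].

Definition H (R : realType) (m : nat) (p theta gamma : 'I_m.+1 -> R) (q : R) :
    \bar R :=
  if q \in domJstar p gamma then
    ereal_inf [set (\sum_(i < m.+1) a i * theta i)%:E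
              | a in minimizers p gamma q]
  else +oo%E.

(* u(x, t) is the slope of one of the affine pieces attaining f(x, t); where
   several pieces attain it, the choice is arbitrary. *)
Definition gradient_selection (R : realType) (m : nat)
    (p theta gamma : 'I_m.+1 -> R) (u : R -> R -> R) : Prop :=
  forall x t, 0 <= t -> exists2 j : 'I_m.+1,
    p j * x - t * theta j - gamma j = f p theta gamma x t & u x t = p j.

Definition locally_lipschitz (R : realType) (F : R -> R) : Prop :=
  forall x : R, exists2 U : set R, nbhs x U & [lipschitz F y | y in U].

Definition partial_x (R : realType) (phi : R -> R -> R) (x t : R) : R :=
  derive1 (fun y : R => phi y t) x.

Definition partial_t (R : realType) (phi : R -> R -> R) (x t : R) : R :=
  derive1 (fun s : R => phi x s) t.

(* Nonnegative C^1 functions with compact support in the whole plane: their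
   restrictions to t >= 0 are the test functions on R x [0, +oo[, which need
   not vanish at t = 0. By mollification C^oo test functions would give the
   same solutions. *)
Definition test_function (R : realType) (phi : R -> R -> R) : Prop :=
  [/\ forall x t : R, 0 <= phi x t,
      forall x t : R, derivable (fun y : R => phi y t) x 1 /\
                  derivable (fun s : R => phi x s) t 1,
      continuous (fun z : R * R => partial_x phi z.1 z.2),
      continuous (fun z : R * R => partial_t phi z.1 z.2) &
      compact (closure [set z : R * R | phi z.1 z.2 != 0])].

Definition halfplane (R : realType) :
    set (measurableTypeR R * measurableTypeR R) := [set z | 0 < z.2].

Definition entropy_integrand (R : realType) (F : R -> R) (v phi : R -> R -> R)
    (k x t : R) : R :=
  `|v x t - k| * partial_t phi x t
  + Num.sg (v x t - k) * (F (v x t) - F k) * partial_x phi x t.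

(* Kruzhkov's inequalities on R x [0, +oo[, for all constants k: the entropy
   |v - k| with flux sgn(v - k) (F(v) - F(k)); the boundary term at t = 0
   expresses the initial condition. *)
Definition kruzhkov (R : realType) (F u0 : R -> R) (v : R -> R -> R) : Prop :=
  forall (k : R) (phi : R -> R -> R), test_function phi ->
    (0 <= \int[@lebesgue_measure R \x @lebesgue_measure R]_(
             z in @halfplane R) (entropy_integrand F v phi k z.1 z.2)%:E
        + \int[@lebesgue_measure R]_x (`|u0 x - k|%R * phi x 0%R)%:E)%E.

(* Bounded entropy solution of u_t + F(u)_x = 0 with initial value u0. As u is
   only meant up to a.e. equality, it need not itself be Borel measurable; it
   must agree a.e. with a bounded Borel function v satisfying the inequalities. *)
Definition entropy_solution (R : realType) (F u0 : R -> R) (u : R -> R -> R) :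
    Prop :=
  exists v : R -> R -> R,
    [/\ measurable_fun (@halfplane R) (fun z => v z.1 z.2),
        exists M : R, forall x t : R, 0 < t -> `|v x t| <= M,
        {ae (@lebesgue_measure R \x @lebesgue_measure R)%E,
          forall z, @halfplane R z -> u z.1 z.2 = v z.1 z.2} &
        kruzhkov F u0 v].

(* Main.v *)
Require Import Defs.
From HB Require Import structures.
From mathcomp Require Import all_boot all_order all_algebra.
From mathcomp Require Import all_classical all_reals all_analysis.
From mathcomp Require Import measurable_realfun.
From mathcomp Require Import ring lra.

Set Implicit Arguments.
Unset Strict Implicit.
Unset Printing Implicit Defensive.

Import Order.TTheory GRing.Theory Num.Theory.
Import numFieldNormedType.Exports.

Local Open Scope classical_set_scope.
Local Open Scope ring_scope.

(* On the open region where piece i is the strict maximum, u = p i; the complement is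
   a finite union of lines. For a Lipschitz W that is affine on each region, two
   discrete summations by parts give
     int (W_x phi_t - W_t phi_x) = 0.
   With W = f - k x + c t this turns the Kruzhkov entropies with k outside the range
   of p into the relations F(p_i) = theta_i + C. For p_i <= k < p_j, write M(t) for the
   minimum of sum_i alpha_i (gamma_i + t theta_i) over the alpha in the simplex with
   mean k, and take W = max(max_(p_j > k) l_j - k x + M(t), 0), where l_j is the piece
   j: W_x = (u - k)^+ and the Kruzhkov functional at k becomes
     2 int_(t > 0) 1_(u > k) (M'(t) + C - F(k)) phi_x.
   As u increases in x, this is nonnegative for all phi >= 0 as soon as
   M'(t) + C <= F(k). Now M is concave and M'(0+) = H(k) by linear programming
   duality, so F >= H + C suffices; and it is necessary because for small t every
   p_i is a value of u(., t), by (A1)-(A3), and M' = H(k). *)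

(** The shock lines are never described: they may meet and pieces may disappear as t grows, so the
    divergence theorem on the regions would require their combinatorics. The difference quotients of
    W are bounded by its Lipschitz constant and converge off the lines, so translation invariance
    and dominated convergence replace integration by parts. With the pieces frozen for t <= 0, the
    whole argument takes place on the plane and no boundary at t = 0 is left.

    The role of M: a potential with x-derivative (u - k)^+ must be truncated, and the truncation has
    to occur where u passes above k. As M(t) is the Legendre transform of f(., t) at k, that is,
    minus the minimum over x of f - k x, adding it brings the crossing to height 0. The price is the
    term M', through which H enters.

    For necessity, the test functions have phi_x positive near one point, negative near another at
    the same time, and zero elsewhere at nearby times. They compare the values in two regions,
    however many shocks lie between. *)

Local Notation plane R := (measurableTypeR R * measurableTypeR R)%type.
Local Notation mu R := (@lebesgue_measure R).
Local Notation mu2 R := (@lebesgue_measure R \x @lebesgue_measure R)%E.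

(** * Translation invariance of planar Lebesgue measure and a class of integrable functions *)

Section translation.
Variable R : realType.

Lemma measurable_addr (a : R) :
  measurable_fun setT (fun x : measurableTypeR R => x + a : measurableTypeR R).
Proof. exact: measurable_funD. Qed.

Lemma lebesgue_measure_addr (a : R) (A : set (measurableTypeR R)) :
  measurable A -> (mu R) ((fun x => x + a) @^-1` A) = (mu R) A.
Proof.
move=> mA; apply/esym.
have mf := measurable_addr a.
pose nu := measure_function_pushforward__canonical__measure_function_Measure (mu R) mf.
apply: (lebesgue_measure_unique (mu := nu)) => // X [[x y] _ <-] /=.
rewrite /pushforward.
have -> : (fun x0 : measurableTypeR R => x0 + a) @^-1` [set` `]x, y]] =
  [set` `]x - a, y - a]].
  by apply/seteqP; split => z /=; rewrite !in_itv/= => /andP[h1 h2];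
    apply/andP; split; lra.
rewrite !lebesgue_measure_itv/= !lte_fin ltrD2r.
by case: ifP => // _; rewrite -!EFinB; congr EFin; ring.
Qed.

Definition shift2 (a b : R) (z : plane R) : plane R := (z.1 + a, z.2 + b).

Lemma measurable_shift2 (a b : R) : measurable_fun setT (shift2 a b).
Proof.
by apply: measurable_fun_pair; apply: measurable_funD.
Qed.

Lemma prod_lebesgue_shift2 (a b : R) (A : set (plane R)) :
  measurable A -> (mu2 R) (shift2 a b @^-1` A) = (mu2 R) A.
Proof.
move=> mA; apply/esym.
have mf := measurable_shift2 a b.
pose nu := measure_function_pushforward__canonical__measure_function_Measure (mu2 R) mf.
apply: (product_measure_unique _ _ (m' := nu)) => // X Y mX mY /=.
rewrite /pushforward.
have -> : shift2 a b @^-1` (X `*` Y) =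
  ((fun x => x + a) @^-1` X) `*` ((fun x => x + b) @^-1` Y) by [].
rewrite -(lebesgue_measure_addr a mX) -(lebesgue_measure_addr b mY).
by rewrite product_measure1E // -[X in measurable X]setTI;
  apply: measurable_addr.
Qed.

(** Bounded Borel functions of bounded support: stable under sums, translations and bounded Borel
    factors, so linearity and shifts of [dint] need no separate integrability proofs. *)
Definition tame (g : plane R -> R) := measurable_fun setT g /\
  exists M r : R, forall z, `|g z| <= M /\
    (g z != 0 -> `|z.1| <= r /\ `|z.2| <= r).

Definition dint (g : plane R -> R) : R := (\int[(mu2 R)]_z g z)%R.

Definition box (r : R) : set (plane R) := `[- r, r]%classic `*` `[- r, r]%classic.

Lemma measurable_box r : measurable (box r).
Proof. by apply: measurableX; exact: measurable_itv. Qed.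

Lemma mu_box r : (mu2 R (box r) < +oo)%E.
Proof.
pose B : set (measurableTypeR R) := `[- r, r]%classic.
have -> : (mu2 R (box r) = (mu R) B * (mu R) B)%E.
  by apply: product_measure1E; exact: measurable_itv.
rewrite lebesgue_measure_itv/=; case: ifP => _; last by rewrite mule0 ltry.
by rewrite -EFinB -EFinM ltry.
Qed.

Lemma boxP (r : R) z : box r z <-> `|z.1| <= r /\ `|z.2| <= r.
Proof. by rewrite /box /= !in_itv /= !ler_norml. Qed.

Lemma integrable_box M r : (mu2 R).-integrable setT (EFin \o (fun z => M * \1_(box r) z)).
Proof.
rewrite (_ : _ \o _ = (fun z => M%:E * (\1_(box r) z)%:E)%E) //.
apply: integrableZl => //.
have mB := measurable_box r.
apply/integrableP; split; first by apply/measurable_EFinP; exact: measurable_indic.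
rewrite (eq_integral (fun x => (\1_(box r) x)%:E)) => [|t _]; last first.
  by rewrite gee0_abs // lee_fin indicE ler0n.
by rewrite integral_indic // setIT; exact: mu_box.
Qed.

Lemma tame_le M r (g : plane R -> R) : (forall z, `|g z| <= M /\
    (g z != 0 -> `|z.1| <= r /\ `|z.2| <= r)) ->
  forall z, `|g z| <= M * \1_(box r) z.
Proof.
move=> h z; have [h1 h2] := h z.
have [g0|/h2/boxP gz] := eqVneq (g z) 0.
  by rewrite g0 normr0 mulr_ge0 // (le_trans _ h1).
by rewrite indicE mem_set ?mulr1.
Qed.

Lemma integrable_bound (g : plane R -> R) M r : measurable_fun setT g ->
  (forall z, `|g z| <= M * \1_(box r) z) -> (mu2 R).-integrable setT (EFin \o g).
Proof.
move=> mg h.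
apply: (le_integrable _ _ _ (integrable_box M r)) => //.
  exact/measurable_EFinP.
move=> z _ /=; rewrite lee_fin; apply: le_trans (h z) _; exact: ler_norm.
Qed.

Lemma tame_integrable g : tame g -> (mu2 R).-integrable setT (EFin \o g).
Proof. by move=> [mg [M [r /tame_le h]]]; exact: integrable_bound h. Qed.


Lemma tame_shift (a b : R) g : tame g -> tame (g \o shift2 a b).
Proof.
move=> [mg [M [r h]]]; split.
  by apply: measurableT_comp mg (measurable_shift2 a b).
exists M, (r + `|a| + `|b|) => z; split; first exact: (h _).1.
move/(h _).2 => /= [h1 h2]; have a0 := normr_ge0 a; have b0 := normr_ge0 b.
split.
  have := ler_normB (z.1 + a) a; rewrite addrK => /le_trans; apply.
  by lra.
have := ler_normB (z.2 + b) b; rewrite addrK => /le_trans; apply.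
by lra.
Qed.

Lemma dint_shift (a b : R) g : tame g -> dint (g \o shift2 a b) = dint g.
Proof.
move=> tg; rewrite /dint /Rintegral; congr fine.
have ms := measurable_shift2 a b.
have <- := @integral_pushforward _ _ _ _ _ _ ms (mu2 R) setT (EFin \o g) _ _ measurableT.
- apply: eq_measure_integral => A mA _.
  exact: (prod_lebesgue_shift2 a b mA).
- by apply/measurable_EFinP; case: tg.
- exact: (tame_integrable (tame_shift a b tg)).
Qed.

Lemma tameD f g : tame f -> tame g -> tame (fun z => f z + g z).
Proof.
move=> [mf [M [r hf]]] [mg [N [s hg]]]; split.
  exact: measurable_funD.
exists (M + N), (Num.max r s) => z; split.
  by apply: le_trans (ler_normD _ _) _; apply: lerD; [exact: (hf z).1|exact: (hg z).1].
have [f0|/(hf z).2[h1 h2] _] := eqVneq (f z) 0.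
  by rewrite f0 add0r => /(hg z).2[h1 h2]; rewrite !le_max h1 h2 !orbT.
by rewrite !le_max h1 h2.
Qed.

Lemma tameMl (f g : plane R -> R) M : measurable_fun setT f -> (forall z, `|f z| <= M) ->
  tame g -> tame (fun z => f z * g z).
Proof.
move=> mf hf [mg [N [s hg]]]; split.
  exact: measurable_funM.
exists (M * N), s => z; split.
  by rewrite normrM; apply: ler_pM => //; exact: (hg z).1.
by rewrite mulf_eq0 negb_or => /andP[_ /(hg z).2].
Qed.

Lemma tameZ c g : tame g -> tame (fun z => c * g z).
Proof. by apply: tameMl => // z; exact: lexx. Qed.

Lemma tameN g : tame g -> tame (fun z => - g z).
Proof.
move/(tameZ (-1)); congr tame.
by apply/funext => z; rewrite mulN1r.
Qed.

Lemma tameB f g : tame f -> tame g -> tame (fun z => f z - g z).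
Proof. by move=> tf /tameN; exact: tameD. Qed.

Lemma dint_D f g : tame f -> tame g -> dint (fun z => f z + g z) = dint f + dint g.
Proof. by move=> /tame_integrable tf /tame_integrable tg; exact: RintegralD. Qed.

Lemma dint_B f g : tame f -> tame g -> dint (fun z => f z - g z) = dint f - dint g.
Proof. by move=> /tame_integrable tf /tame_integrable tg; exact: RintegralB. Qed.

Lemma dint_Z c f : tame f -> dint (fun z => c * f z) = c * dint f.
Proof. by move=> /tame_integrable tf; exact: RintegralZl. Qed.

Lemma dint_le f g : tame f -> tame g -> (forall z, f z <= g z) -> dint f <= dint g.
Proof.
by move=> /tame_integrable tf /tame_integrable tg h; exact: le_Rintegral.
Qed.

Lemma dint_ae (f g : plane R -> R) : measurable_fun setT f -> measurable_fun setT g ->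
  {ae (mu2 R), forall z, f z = g z} -> dint f = dint g.
Proof.
move=> mf mg h; rewrite /dint /Rintegral; congr fine.
apply: ae_eq_integral => //; try exact/measurable_EFinP.
by apply: filterS h => z /= h _; rewrite h.
Qed.

Lemma dint_cvg (f_ : nat -> plane R -> R) (f : plane R -> R) (M r : R) :
  (forall n, measurable_fun setT (f_ n)) -> measurable_fun setT f ->
  (forall n z, `|f_ n z| <= M * \1_(box r) z) ->
  {ae (mu2 R), forall z, f_ ^~ z @ \oo --> (f z : R)} ->
  (fun n => dint (f_ n)) @ \oo --> dint f.
Proof.
move=> mf_ mf h cf.
have [|||||int_f _ cv] := @dominated_convergence _ _ R (mu2 R) setT measurableT
  (fun n => EFin \o f_ n) (EFin \o f) (EFin \o (fun z => M * \1_(box r) z)).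
- by move=> n; apply/measurable_EFinP.
- exact/measurable_EFinP.
- by apply: filterS cf => z cz _; exact: (cvg_comp _ _ cz).
- exact: integrable_box.
- by apply: nearW => z n _; rewrite /= lee_fin.
apply: fine_cvg; rewrite fineK // ; exact: integrable_fin_num.
Qed.

End translation.

(** * Null sets and measurability in the plane; bounds on test functions *)

Section planar.
Variable R : realType.

Lemma ae_not_graph (s : R -> R) : measurable_fun setT s ->
  {ae mu2 R, forall z : plane R, z.1 != s z.2}.
Proof.
move=> ms; set A := [set z : plane R | z.1 = s z.2].
have mA : measurable A.
  rewrite (_ : A = (fun z : plane R => z.1 - s z.2) @^-1` [set 0]).
    rewrite -[X in measurable X]setTI.
    suff : measurable_fun setT (fun z : plane R => z.1 - s z.2).
      by apply => //; exact: measurable_set1.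
    by apply: measurable_funB => //; exact: measurableT_comp.
  by apply/seteqP; split => z /= => [->|/eqP]; rewrite ?subrr // subr_eq0 => /eqP.
exists A; split => //.
(* The product measure slices at fixed [z.1]. The reversed product slices at fixed [z.2], where [A]
   is a single point. *)
- rewrite (product_measure_unique _ _ (m' := (mu R \x^ mu R)%E)) //.
    apply: integral0_eq => y _ /=.
    rewrite (_ : ysection A y = [set s y]) ?lebesgue_measure_set1 //.
    by apply/seteqP; split => x; rewrite /ysection /= inE.
  by move=> X Y mX mY; exact: product_measure2E.
- by move=> z /= /negP; rewrite negbK => /eqP.
Qed.

Lemma ae_t_neq0 : {ae mu2 R, forall z : plane R, z.2 != 0}.
Proof.
exists (setT `*` [set 0]); split.
- by apply: measurableX => //; exact: measurable_set1.
- have -> : (mu2 R (setT `*` [set 0%R]) = mu R setT * mu R [set 0%R])%E.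
    by apply: product_measure1E => //; exact: measurable_set1.
  by rewrite lebesgue_measure_set1 mule0.
- by move=> z /= /negP; rewrite negbK => /eqP.
Qed.

(** The sigma-algebra of the plane is the product one, so an open set has to be exhibited as a
    countable union of measurable rectangles; squares with rational centre and half-side suffice. *)
Lemma open_measurable2 (U : set (R * R)) : open U -> measurable (U : set (plane R)).
Proof.
move=> oU.
pose B (q : rat * rat * rat) : set (plane R) :=
  `]ratr q.1.1 - ratr q.2, ratr q.1.1 + ratr q.2[%classic `*`
  `]ratr q.1.2 - ratr q.2, ratr q.1.2 + ratr q.2[%classic.
pose F q := if `[< B q `<=` U >] then B q else set0.
have -> : U = \bigcup_q F q.
  apply/seteqP; split=> [z Uz|z [q _]]; last first.
    by rewrite /F; case: asboolP => // h; exact: h.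
  have /nbhs_ballP[e /= e0 he] : nbhs z U by exact: open_nbhs_nbhs.
  (* A square of half-side [r] whose centre is within [r] of [z] reaches at most [2 r] away from
     [z], hence the bound [e / 2] on [r]. *)
  have e2 : 0 < e / 2 by lra.
  have [r] := rat_in_itvoo e2; rewrite in_itv /= => /andP[r0 re].
  have h1 : z.1 - ratr r < z.1 + ratr r by lra.
  have h2 : z.2 - ratr r < z.2 + ratr r by lra.
  have [a] := rat_in_itvoo h1; rewrite in_itv /= => /andP[a1 a2].
  have [b] := rat_in_itvoo h2; rewrite in_itv /= => /andP[b1 b2].
  exists (a, b, r) => //; rewrite /F; case: asboolP => h.
    by rewrite /B /= !in_itv /=; split; apply/andP; split; lra.
  exfalso; apply: h => w; rewrite /B /= !in_itv /= => -[/andP[w1 w2] /andP[w3 w4]].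
  apply: he; split; rewrite /ball /= ltr_norml; apply/andP; split; lra.
apply: countable_bigcupT_measurable; first exact: countableP.
move=> q; rewrite /F; case: asboolP => _ //.
by apply: measurableX; exact: measurable_itv.
Qed.

Lemma continuous_measurable2 (g : R * R -> R) : continuous g ->
  measurable_fun setT (g : plane R -> R).
Proof.
move=> /continuousP cg; apply: (measurability _ (RGenOpens.measurableE R)).
move=> _ [_ [a [b ->] <-]]; rewrite setTI.
by apply: open_measurable2; apply: cg; exact: interval_open.
Qed.

Lemma continuous_measurable_partial (phi : R -> R -> R) :
  test_function phi ->
  measurable_fun setT (fun z : plane R => partial_x phi z.1 z.2) /\
  measurable_fun setT (fun z : plane R => partial_t phi z.1 z.2).
Proof.
case=> _ _ cx ct _; exact: (conj (continuous_measurable2 cx) (continuous_measurable2 ct)).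
Qed.

Lemma cvg_diff_quotient (f : R -> R) (x : R) (h_ : nat -> R) :
  derivable f x 1 -> (forall n, h_ n != 0) -> h_ @ \oo --> 0 ->
  (fun n => (f (x + h_ n) - f x) / h_ n) @ \oo --> derive1 f x.
Proof.
move=> df h0 hc; rewrite derive1E.
have /cvgr_dnbhsP/(_ h_ (conj h0 hc)) := df; apply: cvg_trans.
apply: near_eq_cvg; apply: nearW => n /=.
by rewrite [h_ n *: 1]mulr1 [x + _]addrC mulrC.
Qed.

Lemma derive1_eq0 (f : R -> R) (x : R) : (\forall y \near x, f y = 0) ->
  derive1 f x = 0.
Proof.
move=> fx; rewrite derive1E.
rewrite (near_eq_derive _ (g := cst 0)) //.
by rewrite derive_cst.
Qed.

Lemma test_function_support (phi : R -> R -> R) : test_function phi ->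
  exists2 r, 0 < r & forall x t, (r < `|x| \/ r < `|t|) ->
  [/\ phi x t = 0, partial_x phi x t = 0 & partial_t phi x t = 0].
Proof.
case=> phi0 dphi cx ct cpt.
have : bounded_set (closure [set z : R * R | phi z.1 z.2 != 0]).
  exact: compact_bounded.
move=> [M [_ /(_ (`|M| + 1))]]; rewrite /globally /= => /(_ _)/= hM.
have {}hM : forall z : R * R, phi z.1 z.2 != 0 -> `|z| <= `|M| + 1.
  move=> z hz; apply: hM; last exact: subset_closure.
  by rewrite (le_lt_trans (ler_norm _)) // ltrDl.
exists (`|M| + 1) => [|x t hxt]; first by rewrite ltr_wpDl.
have Z : forall x t, (`|M| + 1 < `|x| \/ `|M| + 1 < `|t|) -> phi x t = 0.
  move=> {x t hxt} x t hxt; apply/eqP/negPn/negP => /(hM (x, t)).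
  by rewrite prod_normE /= ge_max => /andP[h1 h2]; case: hxt; lra.
(* The inequality is strict, hence open: outside the box [phi] vanishes on a whole neighbourhood,
   and its partial derivatives vanish too. *)
have N (y : R) : `|M| + 1 < `|y| -> \forall w \near y, `|M| + 1 < `|w|.
  move=> hy; apply/nbhs_ballP; exists (`|y| - (`|M| + 1)) => /=; first lra.
  by move=> w; rewrite /ball /= => h; have := lerB_dist y w; lra.
split; first exact: Z.
- case: hxt => [/N hx|hx]; apply: derive1_eq0; near=> y; apply: Z.
    by left; near: y.
  by right.
- case: hxt => [hx|/N hx]; apply: derive1_eq0; near=> y; apply: Z.
    by left.
  by right; near: y.
Unshelve. all: by end_near. Qed.

Lemma continuous_bounded_support (g : R -> R -> R) (r : R) :
  continuous (fun z : R * R => g z.1 z.2) ->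
  (forall x t, (r < `|x| \/ r < `|t|) -> g x t = 0) ->
  exists M, forall x t, `|g x t| <= M.
Proof.
move=> cg hg; pose K : set (R * R) := `[- r, r]%classic `*` `[- r, r]%classic.
have cK : compact K by apply: compact_setX; exact: segment_compact.
have := compact_bounded (continuous_compact (continuous_subspaceT cg) cK).
move=> [M [_ /(_ (`|M| + 1))]]; rewrite /globally /= => hM.
have {}hM : forall z, K z -> `|g z.1 z.2| <= `|M| + 1.
  move=> z Kz; apply: hM; last by exists z.
  by rewrite (le_lt_trans (ler_norm _)) // ltrDl.
exists (`|M| + 1) => x t; have [xr|xr] := ltP r `|x|.
  by rewrite hg ?normr0 ?addr_ge0 //; left.
have [tr|tr] := ltP r `|t|.
  by rewrite hg ?normr0 ?addr_ge0 //; right.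
by apply: (hM (x, t)); split; rewrite /= in_itv /= -ler_norml.
Qed.

Definition lip2 (M : R) (W : R -> R -> R) := 0 <= M /\
  forall x y s t, `|W x s - W y t| <= M * (`|x - y| + `|s - t|).

Lemma lip2_continuous M W : lip2 M W -> continuous (fun z : R * R => W z.1 z.2).
Proof.
move=> [M0 hW] z; apply/cvgrPdist_lt => e e0.
have M1 : 0 < M + 1 by lra.
have d0 : 0 < e / (2 * (M + 1)) by rewrite divr_gt0 // mulr_gt0.
have hb := nbhsx_ballx z _ d0.
near=> w.
apply: le_lt_trans (hW _ _ _ _) _.
have : ball z (e / (2 * (M + 1))) w by near: w; exact: hb.
move=> [h1 h2]; rewrite /ball /= in h1 h2.
have E : e = (M + 1) * (e / (2 * (M + 1)) + e / (2 * (M + 1))) by field; lra.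
rewrite E; apply: (@le_lt_trans _ _ ((M + 1) * (`|z.1 - w.1| + `|z.2 - w.2|))).
  by rewrite ler_wpM2r ?addr_ge0 //; lra.
by rewrite ltr_pM2l // ltrD.
Unshelve. all: by end_near. Qed.

Lemma mvt_lipschitz (f : R -> R) (M : R) : (forall x, derivable f x 1) ->
  (forall x, `|derive1 f x| <= M) -> forall x y, `|f x - f y| <= M * `|x - y|.
Proof.
move=> df hM.
have W : forall x y, y < x -> `|f x - f y| <= M * `|x - y|.
  move=> x y xy; have [|||c _ ->] := @MVT R f (derive1 f) y x => //.
  - by move=> z _; rewrite derive1E; apply/derivableP.
  - apply: derivable_within_continuous => z _; exact: df.
  - by rewrite normrM ler_wpM2r.
move=> x y; case: (ltgtP x y) => [xy|xy|->].
- by rewrite distrC (distrC x); exact: W.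
- exact: W.
- by rewrite !subrr normr0 mulr0.
Qed.

Lemma test_function_bounds (phi : R -> R -> R) : test_function phi ->
  exists M r, [/\ 0 <= M, 0 < r, lip2 M phi,
   forall x t, `|phi x t| <= M /\ `|partial_x phi x t| <= M /\ `|partial_t phi x t| <= M &
   forall x t, (r < `|x| \/ r < `|t|) ->
    [/\ phi x t = 0, partial_x phi x t = 0 & partial_t phi x t = 0] ].
Proof.
move=> tf; have [r r0 hr] := test_function_support tf.
case: tf => phi0 dphi cx ct _.
have [Mx hMx] := continuous_bounded_support cx (fun x t h => (let: And3 _ h _ := hr x t h
  in h)).
have [Mt hMt] := continuous_bounded_support ct (fun x t h => (let: And3 _ _ h := hr x t h
  in h)).
have Mx0 : 0 <= Mx := le_trans (normr_ge0 _) (hMx 0 0).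
have Mt0 : 0 <= Mt := le_trans (normr_ge0 _) (hMt 0 0).
have L : lip2 (Mx + Mt) phi.
  split => [|x y s t]; first exact: addr_ge0.
  have h1 := mvt_lipschitz (fun x => (dphi x s).1) (hMx ^~ s) x y.
  have h2 := mvt_lipschitz (fun t => (dphi y t).2) (hMt y) s t.
  have := ler_distD (phi y s) (phi x s) (phi y t).
  have n1 := normr_ge0 (x - y); have n2 := normr_ge0 (s - t).
  have n3 := mulr_ge0 Mx0 n2; have n4 := mulr_ge0 Mt0 n1.
  by move=> /le_trans; apply; move: h1 h2 => /=; rewrite !mulrDl !mulrDr; lra.
have [Mp hMp] := continuous_bounded_support (lip2_continuous L) (fun x t h => (let: And3
  h _ _ := hr x t h in h)).
have Mp0 : 0 <= Mp := le_trans (normr_ge0 _) (hMp 0 0).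
exists (Mx + Mt + Mp), r; split => //; first lra.
  split => [|x y s t]; first lra.
  case: L => _ /(_ x y s t) /le_trans; apply; rewrite ler_wpM2r //; lra.
by move=> x t; have := hMp x t; have := hMx x t; have := hMt x t; split; [|split]; lra.
Qed.

End planar.

(** * The vanishing of the distributional curl of a Lipschitz gradient *)

Section curl.
Variable R : realType.

Lemma tame_lip2_mul M (W : R -> R -> R) (g : plane R -> R) : lip2 M W -> tame g ->
  tame (fun z => W z.1 z.2 * g z).
Proof.
move=> lW [mg [N [r h]]]; split.
  by apply: measurable_funM => //; exact: continuous_measurable2 (lip2_continuous lW).
exists ((`|W 0 0| + M * (`|r| + `|r|)) * N), r => z; split; last first.
  by rewrite mulf_eq0 negb_or => /andP[_ /(h _).2].
have N0 : 0 <= N by apply: le_trans (h z).1.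
have [M0 hW] := lW.
have [g0|/(h z).2[h1 h2]] := eqVneq (g z) 0.
  by rewrite g0 mulr0 normr0 mulr_ge0 // addr_ge0 // mulr_ge0 // addr_ge0.
rewrite normrM ler_pM //; last exact: (h z).1.
have := hW z.1 0 z.2 0; rewrite !subr0 => h3.
have := lerB_dist (W z.1 z.2) (W 0 0) => h4.
have : M * (`|z.1| + `|z.2|) <= M * (`|r| + `|r|).
  by rewrite ler_wpM2l // lerD // (le_trans _ (ler_norm _)).
by lra.
Qed.

Lemma tame_test (phi : R -> R -> R) : test_function phi ->
  [/\ tame (fun z => phi z.1 z.2), tame (fun z => partial_x phi z.1 z.2) &
      tame (fun z => partial_t phi z.1 z.2)].
Proof.
move=> tf; have [M [r [M0 r0 L hb hs]]] := test_function_bounds tf.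
have [mx mt] := continuous_measurable_partial tf.
have mp := continuous_measurable2 (lip2_continuous L).
have S (z : plane R) : ~~ (`|z.1| <= r) || ~~ (`|z.2| <= r) ->
    [/\ phi z.1 z.2 = 0, partial_x phi z.1 z.2 = 0 & partial_t phi z.1 z.2 = 0].
  by rewrite -!ltNge => /orP h; exact: hs.
split; split => //; exists M, r => z; split; try by case: (hb z.1 z.2) => ? [].
- move=> /eqP z0; split; apply: contrapT => /negP h; apply: z0.
    by case: (S z) => //; rewrite h.
  by case: (S z) => //; rewrite h orbT.
- move=> /eqP z0; split; apply: contrapT => /negP h; apply: z0.
    by case: (S z) => //; rewrite h.
  by case: (S z) => //; rewrite h orbT.
- move=> /eqP z0; split; apply: contrapT => /negP h; apply: z0.
    by case: (S z) => //; rewrite h.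
  by case: (S z) => //; rewrite h orbT.
Qed.

Lemma lip2_quot_x M (W : R -> R -> R) x t h : lip2 M W -> h != 0 ->
  `|(W (x + h) t - W x t) / h| <= M.
Proof.
move=> [M0 hW] h0; rewrite normrM normfV ler_pdivrMr ?normr_gt0 //.
by have := hW (x + h) x t t; rewrite subrr normr0 addr0 (addrC x) addrK.
Qed.

Lemma lip2_quot_t M (W : R -> R -> R) x t h : lip2 M W -> h != 0 ->
  `|(W x (t + h) - W x t) / h| <= M.
Proof.
move=> [M0 hW] h0; rewrite normrM normfV ler_pdivrMr ?normr_gt0 //.
by have := hW x x (t + h) t; rewrite subrr normr0 add0r (addrC t) addrK.
Qed.

(* Summation by parts, twice: moving both difference quotients from one factor
   to the other turns forward differences into backward ones. *)
Lemma dint_diff_quotients M (W phi : R -> R -> R) (h : R) : lip2 M W ->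
  tame (fun z => phi z.1 z.2) ->
  let q z := (W (z.1 + h) z.2 - W z.1 z.2) * (phi z.1 (z.2 - h) - phi z.1 z.2)
    - (W z.1 (z.2 + h) - W z.1 z.2) * (phi (z.1 - h) z.2 - phi z.1 z.2) in
  tame q /\ dint q = 0.
Proof.
move=> lW tp q; pose P z := phi z.1 z.2 : R.
have lx : lip2 M (fun x t => W (x + h) t).
  case: lW => M0 hW; split => // x y s t.
  by have := hW (x + h) (y + h) s t; rewrite opprD addrACA subrr addr0.
have lt : lip2 M (fun x t => W x (t + h)).
  case: lW => M0 hW; split => // x y s t.
  by have := hW x y (s + h) (t + h); rewrite opprD [s + h + _]addrACA subrr addr0.
have tpx := tame_shift (- h) 0 tp.
have tpt := tame_shift 0 (- h) tp.
pose G1 (z : plane R) := W (z.1 + h) z.2 * P (shift2 0 (- h) z).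
pose G2 (z : plane R) := W (z.1 + h) z.2 * P z.
pose G3 (z : plane R) := W z.1 z.2 * P (shift2 0 (- h) z).
pose K1 (z : plane R) := W z.1 (z.2 + h) * P (shift2 (- h) 0 z).
pose K2 (z : plane R) := W z.1 (z.2 + h) * P z.
pose K3 (z : plane R) := W z.1 z.2 * P (shift2 (- h) 0 z).
have tG1 : tame G1 by exact: (tame_lip2_mul lx tpt).
have tG2 : tame G2 by exact: (tame_lip2_mul lx tp).
have tG3 : tame G3 by exact: (tame_lip2_mul lW tpt).
have tK1 : tame K1 by exact: (tame_lip2_mul lt tpx).
have tK2 : tame K2 by exact: (tame_lip2_mul lt tp).
have tK3 : tame K3 by exact: (tame_lip2_mul lW tpx).
have E1 : dint K1 = dint G1.
  rewrite -(dint_shift (- h) h tG1); congr dint; apply/funext => z /=.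
  by rewrite /K1 /G1 /P /= addrNK addrK !addr0.
have E2 : dint K3 = dint G2.
  rewrite -(dint_shift (- h) 0 tG2); congr dint; apply/funext => z /=.
  by rewrite /K3 /G2 /P /= addrNK !addr0.
have E3 : dint K2 = dint G3.
  rewrite -(dint_shift 0 h tG3); congr dint; apply/funext => z /=.
  by rewrite /K2 /G3 /P /= addrK !addr0.
have tG : tame (fun z => G2 z + G3 z) by exact: tameD.
have tK : tame (fun z => K2 z + K3 z) by exact: tameD.
have tG' : tame (fun z => G1 z - (G2 z + G3 z)) by exact: tameB.
have tK' : tame (fun z => K1 z - (K2 z + K3 z)) by exact: tameB.
have -> : q = (fun z => (G1 z - (G2 z + G3 z)) - (K1 z - (K2 z + K3 z))).
  apply/funext => z; rewrite /q /G1 /G2 /G3 /K1 /K2 /K3 /P /= !addr0; ring.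
split; first exact: tameB.
by rewrite dint_B // !dint_B // !dint_D // E1 E2 E3; ring.
Qed.

(** Only a.e. limits along the steps [harmonic n] are required, so no differentiability theorem for
    Lipschitz functions enters. The discrete identity is exact for each [n], and all quotients are
    bounded by Lipschitz constants, so dominated convergence passes to the limit. *)
Lemma dint_curl M (phi W : R -> R -> R) (A B : plane R -> R) :
  test_function phi -> lip2 M W ->
  measurable_fun setT A -> measurable_fun setT B ->
  {ae mu2 R, forall z : plane R,
    (fun n => (W (z.1 + harmonic n) z.2 - W z.1 z.2) / harmonic n) @ \oo --> (A z : R)} ->
  {ae mu2 R, forall z : plane R,
    (fun n => (W z.1 (z.2 + harmonic n) - W z.1 z.2) / harmonic n) @ \oo --> (B z : R)} ->
  dint (fun z => A z * partial_t phi z.1 z.2 - B z * partial_x phi z.1 z.2) = 0.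
Proof.
move=> tf lW mA mB cA cB.
have [N [r [N0 r0 L hb hs]]] := test_function_bounds tf.
have [tp tx tt] := tame_test tf.
pose q (n : nat) (z : plane R) :=
  (W (z.1 + harmonic n) z.2 - W z.1 z.2) / harmonic n *
     ((phi z.1 (z.2 - harmonic n) - phi z.1 z.2) / - harmonic n)
  - (W z.1 (z.2 + harmonic n) - W z.1 z.2) / harmonic n *
     ((phi (z.1 - harmonic n) z.2 - phi z.1 z.2) / - harmonic n).
have hn0 n : harmonic n != 0 :> R by rewrite /harmonic /= invr_eq0 pnatr_eq0.
have hnN0 n : - harmonic n != 0 :> R by rewrite oppr_eq0.
have cN : (fun n => - harmonic n : R) @ \oo --> 0.
  by rewrite -[X in _ --> X]oppr0; apply: cvgN; exact: cvg_harmonic.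
have q0 n : tame (q n) /\ dint (q n) = 0.
  have [tq iq] := dint_diff_quotients (harmonic n) lW tp.
  (* The quotients of [W] are divided by the step and the backward ones of [phi] by its opposite,
     whence the sign. *)
  pose c : R := - (harmonic n * harmonic n)^-1.
  rewrite (_ : q n = (fun z => c * ((W (z.1 + harmonic n) z.2 - W z.1 z.2) *
       (phi z.1 (z.2 - harmonic n) - phi z.1 z.2)
    - (W z.1 (z.2 + harmonic n) - W z.1 z.2) *
      (phi (z.1 - harmonic n) z.2 - phi z.1 z.2)))).
    by split; [exact: tameZ|rewrite dint_Z // iq mulr0].
  by apply/funext => z; rewrite /q /c; field; exact: hn0.
(* Shifting by [harmonic n], which is at most 1, enlarges the support of [phi]; the box of radius
   [r + 1] contains all the supports. *)
have := @dint_cvg _ q (fun z => A z * partial_t phi z.1 z.2 - B z * partial_x phi z.1 z.2)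
  (M * N + M * N) (r + 1).
rewrite (_ : (fun n => dint (q n)) = (fun=> 0)); last first.
  by apply/funext => n; case: (q0 n).
move=> H; apply/esym; apply: (cvg_unique _ (cvg_cst _) (H _ _ _ _)) => //.
- by move=> n; case: (q0 n) => -[].
- by apply: measurable_funB; apply: measurable_funM => //; case: tx tt => + _ [].
- move=> n; apply: tame_le => z; split.
    rewrite (le_trans (ler_normB _ _)) // !normrM lerD // -!normrM normrM ler_pM //.
    - exact: lip2_quot_x.
    - by have := lip2_quot_t z.1 z.2 L (hnN0 n).
    - exact: lip2_quot_t.
    - by have := lip2_quot_x z.1 z.2 L (hnN0 n).
  have hn1 : `|harmonic n : R| <= 1.
    by rewrite ger0_norm ?harmonic_ge0 // /harmonic /= invf_le1 ?ler1n ?ltr0n.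
  have T (a : R) : r + 1 < `|a| -> r < `|a| /\ r < `|a - harmonic n|.
    by have := lerB_dist a (harmonic n); lra.
  have S x t : r + 1 < `|x| \/ r + 1 < `|t| ->
     [/\ phi x t = 0, phi (x - harmonic n) t = 0 & phi x (t - harmonic n) = 0].
    move=> h; split; [have [] // := hs x t|have [] // := hs (x - harmonic n) t
       |have [] // := hs x (t - harmonic n)]; case: h => /T[? ?]; tauto.
  move=> /eqP qz; split; apply: contrapT => /negP; rewrite -ltNge => hz; apply: qz.
    by rewrite /q; case: (S z.1 z.2) => [|-> -> ->]; [left|ring].
  by rewrite /q; case: (S z.1 z.2) => [|-> -> ->]; [right|ring].
- apply: filterS2 cA cB => z cA cB; rewrite /q.
  case: tf => _ dphi _ _ _.
  apply: cvgB; apply: cvgM => //.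
    exact: (cvg_diff_quotient (dphi z.1 z.2).2 hnN0 cN).
  exact: (cvg_diff_quotient (dphi z.1 z.2).1 hnN0 cN).
Qed.

End curl.

(** * The initial term as an integral over the lower half-plane *)

Section boundary.
Variable R : realType.

Lemma integral_halfline_derive (f : R -> R) (r : R) : 0 < r ->
  (forall x, derivable f x 1) -> continuous (derive1 f) ->
  (forall x, r < `|x| -> f x = 0 /\ derive1 f x = 0) ->
  (\int[mu R]_y ((y <= 0)%R%:R * derive1 f y)%R%:E = (f 0)%:E)%E.
Proof.
move=> r0 df cf fr.
(* The endpoint is beyond [- r] because vanishing is known only for absolute values strictly above
   [r]. *)
have f0 : f (- (r + 1)) = 0 by case: (fr (- (r + 1))) => //; rewrite normrN ger0_norm; lra.
pose B : set R := `[- (r + 1), 0]%classic.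
transitivity (\int[mu R]_(y in B) (derive1 f y)%:E)%E; last first.
  have cf' : continuous f by move=> x; exact/differentiable_continuous/derivable1_diffP.
  have lt0 : - (r + 1) < 0 by lra.
  have dLR : derivable_oo_LRcontinuous f (- (r + 1)) 0.
    split => [x _||]; first exact: df.
    + by apply: cvg_at_right_filter; exact: cf'.
    + by apply: cvg_at_left_filter; exact: cf'.
  have := continuous_FTC2 lt0 (continuous_subspaceT cf) dLR (fun x _ => erefl).
  by rewrite f0 -EFinB subr0.
rewrite [RHS]integral_mkcond; apply: eq_integral => y _.
rewrite patchE; case: ifPn => [/set_mem|/negP hy].
  by rewrite /B /= in_itv /= => /andP[_ ->]; rewrite mul1r.
have [y0|] := leP y 0; last by rewrite mul0r.
rewrite mul1r (fr y _).2 // ler0_norm // ltrNr ltNge; apply/negP => h'.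
by apply: hy; apply/mem_set; rewrite /B /= in_itv /= y0 andbT; lra.
Qed.

Lemma integrable_bounded_support (g : R -> R) (M r : R) :
  measurable_fun setT g -> (forall x, `|g x| <= M) ->
  (forall x, r < `|x| -> g x = 0) -> (mu R).-integrable setT (EFin \o g).
Proof.
move=> mg hM hr.
have iB : (mu R).-integrable setT (fun x => M%:E * (\1_(`[- r, r]%classic : set R) x)%:E)%E.
  by apply: integrableZl => //; exact: integrable_indic_itv.
apply: (le_integrable _ _ _ iB) => //; first exact/measurable_EFinP.
move=> x _ /=; rewrite lee_fin indicE.
have [xr|/negP xr] := boolP (x \in (`[- r, r]%classic : set R)).
  by rewrite mulr1 (le_trans (hM x)) // ler_norm.
rewrite mulr0 normr0 hr ?normr0 // ltNge; apply/negP => h; apply: xr.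
by apply/mem_set; rewrite /= in_itv /= -ler_norml.
Qed.

Lemma measurable_snd_le0 :
  measurable_fun setT (fun z : plane R => ((z.2 : R) <= 0)%R%:R : R).
Proof.
rewrite (_ : (fun z => _) = \1_[set z : plane R | z.2 <= 0 :> R]); last first.
  apply/funext => z; rewrite indicE; congr ((nat_of_bool _)%:R).
  by apply/idP/idP; rewrite inE.
apply: measurable_indic.
rewrite (_ : [set z | _] = setT `*` [set` `]-oo, (0 : R)]]).
  by apply: measurableX => //; exact: measurable_itv.
by apply/seteqP; split => z /=; rewrite in_itv /= => // -[].
Qed.

Lemma measurable_snd_gt0 :
  measurable_fun setT (fun z : plane R => (0 < (z.2 : R))%R%:R : R).
Proof.
rewrite (_ : (fun z => _) = (fun z : plane R => 1 - ((z.2 : R) <= 0)%R%:R)).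
  by apply: measurable_funB => //; exact: measurable_snd_le0.
by apply/funext => z; rewrite ltNge; case: (_ <= _); rewrite /= ?subrr ?subr0.
Qed.

Lemma ler_norm_bool (b : bool) : `|b%:R : R| <= 1.
Proof. by case: b; rewrite ?normr1 ?normr0. Qed.

(** Integrating in t first, the integral of [partial_t phi] over t <= 0 is [phi x 0]. The trace at t
    = 0 thus becomes a planar integral, of the same kind as the interior term. *)
Lemma dint_boundary (c : R -> R) (M : R) (phi : R -> R -> R) :
  measurable_fun setT c -> (forall x, `|c x| <= M) -> test_function phi ->
  tame (fun z => c z.1 * (((z.2 : R) <= 0)%R%:R * partial_t phi z.1 z.2)) /\
  ((dint (fun z => c z.1 * (((z.2 : R) <= 0)%R%:R * partial_t phi z.1 z.2)))%R%:E =
  \int[mu R]_x (c x * phi x 0)%R%:E)%E.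
Proof.
move=> mc hc tf; have [tp tx tt] := tame_test tf.
have [N [r [N0 r0 L hb hr]]] := test_function_bounds tf.
set g := fun z : plane R => _.
have tg : tame g.
  rewrite /g; apply: (@tameMl _ (fun z => c z.1) _ M) => //.
    exact: measurableT_comp.
  apply: (@tameMl _ (fun z : plane R => ((z.2 : R) <= 0)%R%:R) _ 1) => //.
    exact: measurable_snd_le0.
  by move=> z; exact: ler_norm_bool.
split => //; have ig := tame_integrable tg.
rewrite /dint /Rintegral fineK; last exact: integrable_fin_num.
rewrite -integral12_prod_meas1 //; apply: eq_integral => x _.
rewrite /fubini_F /g /=.
have cd : continuous (derive1 (phi x)).
  case: tf => _ _ _ ct _ t.
  apply: (@continuous_comp _ _ _ (fun t : R => (x, t)) (fun z => partial_t phi z.1 z.2)).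
    apply/cvg_ballP => e e0; apply/nbhs_ballP; exists e => // s ts.
    by split => //=; exact: ballxx.
  exact: ct.
under eq_integral do rewrite EFinM.
rewrite integralZl //; last first.
  apply: (@integrable_bounded_support _ N r) => //.
  - apply: measurable_funM.
      exact: (measurableT_comp measurable_snd_le0 (pair1_measurable x)).
    exact: continuous_measurable_fun.
  - move=> t; rewrite normrM -[N]mul1r ler_pM ?ler_norm_bool //.
    by case: (hb x t) => _ [].
  - by move=> t ht; case: (hr x t) => [|_ _ ->]; [right|rewrite mulr0].
rewrite EFinM; congr (_ * _)%E.
apply: (@integral_halfline_derive (phi x) r r0 _ cd) => [t|t ht].
  by case: tf => _ dphi _ _ _; exact: (dphi x t).2.
by have [h0 _ h1] := hr x t (or_intror ht).
Qed.

End boundary.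

(** * Finite maxima, and minima of finitely many affine functions of time *)

Section finite_max.
Variables (R : realType) (T : finType) (P : pred T) (i0 : T).
Hypothesis Pi0 : P i0.
Implicit Types a b : T -> R.

(** Since [P i0] holds, the default [a i0] is itself one of the terms, and this is the true maximum
    over [P]. *)
Definition bmax a : R := \big[Num.max/a i0]_(i | P i) a i.

Lemma bmax_ub a i : P i -> a i <= bmax a.
Proof. by move=> Pi; exact: le_bigmax_cond. Qed.

Lemma bmax_mem a : exists2 i, P i & bmax a = a i.
Proof.
rewrite /bmax; elim/big_rec: _ => [|i x Pi [j Pj ->]]; first by exists i0.
by case: (leP (a i) (a j)) => _; [exists j|exists i].
Qed.

Lemma bmax_eq a i : P i -> (forall j, P j -> a j <= a i) -> bmax a = a i.
Proof.
move=> Pi h; apply/eqP; rewrite eq_le bmax_ub // andbT.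
by have [j Pj ->] := bmax_mem a; exact: h.
Qed.

Lemma bmax_dist a b c : (forall i, P i -> `|a i - b i| <= c) ->
  `|bmax a - bmax b| <= c.
Proof.
move=> h; have [i Pi ai] := bmax_mem a; have [j Pj bj] := bmax_mem b.
have := bmax_ub b Pi; have := bmax_ub a Pj; rewrite ai bj.
have := h i Pi; have := h j Pj; rewrite !ler_norml => /andP[? ?] /andP[? ?] ? ?.
by apply/andP; split; lra.
Qed.

Lemma lip2_bmax (M : R) (W : T -> R -> R -> R) : 0 <= M ->
  (forall i, lip2 M (W i)) -> lip2 M (fun x t => bmax (fun i => W i x t)).
Proof. by move=> M0 h; split => // x y s t; apply: bmax_dist => i _; exact: (h i).2. Qed.

(** A concave, piecewise affine function of [t], written through [bmax] so that the estimates for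
    maxima apply. *)
Definition amin (c b : T -> R) (t : R) : R := - bmax (fun q => - (c q + t * b q)).

Lemma amin_le c b t q : P q -> amin c b t <= c q + t * b q.
Proof. by move=> Pq; rewrite /amin lerNl; exact: (bmax_ub (fun q => - (c q + t * b q))).
  Qed.

Lemma amin_mem c b t : exists2 q, P q & amin c b t = c q + t * b q.
Proof.
by have [q Pq h] := bmax_mem (fun q => - (c q + t * b q)); exists q => //; rewrite /amin
  h opprK.
Qed.

(** Among the lines that attain the minimum at [t], one of least slope stays minimal just after [t]:
    tied lines rise at least as fast, and the others start strictly above and need a positive time
    to catch up. *)
Lemma amin_right_affine c b t : exists q, [/\ P q, amin c b t = c q + t * b q &
  exists2 e, 0 < e & forall s, t <= s < t + e -> amin c b s = c q + s * b q].
Proof.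
pose Q q := P q && (c q + t * b q == amin c b t).
have [q0 Pq0 hq0] := amin_mem c b t.
have Qq0 : Q q0 by rewrite /Q Pq0 hq0 eqxx.
pose q := [arg min_(i < q0 | Q i) b i]%O.
have [/andP[Pq /eqP hq] qmin] : Q q /\ forall q', Q q' -> b q <= b q'.
  by rewrite /q; case: arg_minP.
exists q; split => //.
have F : \forall s \near t, forall q', P q' -> t <= s -> c q + s * b q <= c q' + s * b q'.
  suff F1 q' : \forall s \near t, P q' -> t <= s -> c q + s * b q <= c q' + s * b q'.
    exact: (@filter_forall _ _ _ (nbhs t) _ F1).
  have [Pq'|nP] := boolP (P q'); last by near=> s.
  have := amin_le c b t Pq'; rewrite -hq le_eqVlt => /orP[/eqP hq'|lt].
    have bq : b q <= b q' by apply: qmin; rewrite /Q Pq' -hq' hq eqxx.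
    near=> s => _ ts.
    have : (s - t) * b q <= (s - t) * b q' by rewrite ler_wpM2l // subr_ge0.
    by move: hq'; rewrite !mulrBl; lra.
  (* The sum of the absolute slopes bounds the rate at which the gap closes; the added 1 keeps the
     divisor positive. *)
  have K0 : 0 < `|b q| + `|b q'| + 1 by have := normr_ge0 (b q); have := normr_ge0 (b
    q'); lra.
  set d := (c q' + t * b q' - (c q + t * b q)) / (`|b q| + `|b q'| + 1).
  have d0 : 0 < d by rewrite divr_gt0 // subr_gt0.
  have hb := nbhsx_ballx t _ d0.
  near=> s => _ ts.
  have : ball t d s by near: s; exact: hb.
  rewrite /ball /= distrC ger0_norm ?subr_ge0 // => st.
  have h1 : (s - t) * b q <= (s - t) * `|b q| by rewrite ler_wpM2l ?subr_ge0 // ler_norm.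
  have h2 : (s - t) * - b q' <= (s - t) * `|b q'|.
    by rewrite ler_wpM2l ?subr_ge0 // -normrN ler_norm.
  have h3 : (s - t) * (`|b q| + `|b q'| + 1) <= c q' + t * b q' - (c q + t * b q).
    by rewrite -ler_pdivlMr //; apply/ltW.
  by move: h1 h2 h3; rewrite !mulrDr mulrN mulr1 !mulrBl; lra.
have /nbhs_ballP[e /= e0 he] := F; exists e => // s /andP[ts se].
have {}he : forall q', P q' -> c q + s * b q <= c q' + s * b q'.
  move=> q' Pq'; apply: he => //.
  by rewrite /ball /= distrC ger0_norm ?subr_ge0 //; lra.
apply/eqP; rewrite eq_le amin_le //=.
by have [q' Pq' ->] := amin_mem c b s; exact: he.
Unshelve. all: by end_near. Qed.

Lemma amin_dist c b M s t : (forall q, P q -> `|b q| <= M) ->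
  `|amin c b s - amin c b t| <= M * `|s - t|.
Proof.
move=> h; rewrite /amin opprK addrC distrC; rewrite distrC.
have := @bmax_dist (fun q => - (c q + t * b q)) (fun q => - (c q + s * b q)) (M * `|s - t|).
apply => q Pq.
rewrite (_ : _ - _ = b q * (s - t)); last ring.
by rewrite normrM ler_wpM2r // h.
Qed.

Lemma cvg_slope (f : R -> R) (t c e : R) : 0 < e ->
  (forall h, 0 < h < e -> f (t + h) - f t = h * c) ->
  (fun n => (f (t + harmonic n) - f t) / harmonic n) @ \oo --> c.
Proof.
move=> e0 h; apply: cvg_near_cst.
have : \forall n \near \oo, (harmonic n : R) < e.
  have : @harmonic R @ \oo --> 0 by exact: cvg_harmonic.
  by move/cvgr_lt; exact.
apply: filterS => n hn; rewrite h ?hn ?andbT ?harmonic_gt0 //.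
by rewrite mulrAC divff ?mul1r // gt_eqF // harmonic_gt0.
Qed.

(** The active line is selected by choice, which gives no measurability. The slope is Borel because
    it is the pointwise limit of difference quotients of the continuous function [amin]. *)
Lemma amin_slope c b : exists dh : R -> R, measurable_fun setT dh /\
  forall t, exists q, [/\ P q, dh t = b q, amin c b t = c q + t * b q &
  exists2 e, 0 < e & forall s, t <= s < t + e -> amin c b s = c q + s * b q].
Proof.
have [Q hQ] := choice (amin_right_affine c b).
exists (b \o Q); split; last by move=> t; exists (Q t); case: (hQ t).
apply: (measurable_fun_cvg (h := 
  fun n (t : measurableTypeR R) => (amin c b (t + harmonic n) - amin c b t) / harmonic n)).
  move=> n; apply: measurable_funM => //.
  have ca : continuous (amin c b).
    pose M := \sum_q `|b q|.
    have hM q : P q -> `|b q| <= M.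
      by move=> _; rewrite /M (bigD1 q) //= lerDl sumr_ge0.
    have M0 : 0 <= M by rewrite sumr_ge0.
    move=> t; apply/cvgrPdist_lt => e e0.
    have d0 : 0 < e / (M + 1) by rewrite divr_gt0 //; lra.
    apply/nbhs_ballP; exists (e / (M + 1)) => // s; rewrite /ball /= => ts.
    apply: le_lt_trans (amin_dist c t s hM) _.
    apply: (@le_lt_trans _ _ ((M + 1) * `|t - s|)).
      by rewrite ler_wpM2r //; lra.
    by rewrite mulrC -ltr_pdivlMr //; lra.
  have mc := continuous_measurable_fun ca.
  by apply: measurable_funB => //; apply: measurableT_comp => //; exact: measurable_addr.
move=> t _; have [Pq ht [e e0 he]] := hQ t.
apply: (cvg_slope e0) => h /andP[h0 hlt].
by rewrite he ?ht; [rewrite /=; ring|apply/andP; split; lra].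
Qed.

End finite_max.

(** * The regions where one affine piece strictly dominates *)

Section regions.
Variables (R : realType) (m : nat) (p theta gamma : 'I_m.+1 -> R).

(* Extending the pieces to t < 0 by their values at t = 0 turns the initial
   condition into a contribution of the lower half-plane. *)
Definition piece (i : 'I_m.+1) (x t : R) : R :=
  p i * x - Num.max t 0 * theta i - gamma i.

Definition region (i : 'I_m.+1) : set (plane R) :=
  [set z | forall j, j != i -> piece j z.1 z.2 < piece i z.1 z.2].

(** [step p] is a Borel representative of [u]: ties, where [u] is an arbitrary choice, receive the
    value 0 and form a null set. *)
Definition step (a : 'I_m.+1 -> R) (z : plane R) : R :=
  \sum_i a i * \1_(region i) z.

Definition pbound : R := \sum_i (`|p i| + `|theta i|).

Lemma pbound_ge i : `|p i| <= pbound /\ `|theta i| <= pbound.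
Proof.
have h : `|p i| + `|theta i| <= pbound.
  by rewrite /pbound (bigD1 i) //= lerDl sumr_ge0 // => j _; rewrite addr_ge0.
by have := normr_ge0 (p i); have := normr_ge0 (theta i); split; lra.
Qed.

Lemma pbound_ge0 : 0 <= pbound.
Proof. by rewrite sumr_ge0 // => j _; rewrite addr_ge0. Qed.

Lemma max0_dist (s t : R) : `|Num.max s 0 - Num.max t 0| <= `|s - t|.
Proof.
rewrite ler_norml; have := ler_norm (s - t); have := ler_norm (t - s).
rewrite [`|t - s|]distrC.
case: (leP s 0) => hs; case: (leP t 0) => ht h1 h2; apply/andP; split; lra.
Qed.

Lemma lip2_piece i : lip2 pbound (piece i).
Proof.
split => [|x y s t]; first exact: pbound_ge0.
rewrite /piece (_ : _ - _ = p i * (x - y) - theta i * (Num.max s 0 - Num.max t 0)); last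
  ring.
rewrite (le_trans (ler_normB _ _)) // !normrM mulrDr lerD //.
  by rewrite ler_wpM2r //; case: (pbound_ge i).
by rewrite ler_pM // ?max0_dist //; case: (pbound_ge i).
Qed.

Lemma region_uniq i j z : region i z -> region j z -> i = j.
Proof.
move=> hi hj; apply/eqP/negPn/negP => ij.
by have := hi j; rewrite eq_sym => /(_ ij); have := hj i ij; lra.
Qed.

Lemma stepE a i z : region i z -> step a z = a i.
Proof.
move=> hi; rewrite /step (bigD1 i) //= big1 ?addr0 => [|j ji].
  by rewrite indicE mem_set ?mulr1.
rewrite indicE memNset ?mulr0 // => hj.
by move: ji; rewrite (region_uniq hj hi) eqxx.
Qed.

Lemma open_region i : open (region i : set (R * R)).
Proof.
rewrite openE => z hz; rewrite /interior /=.
suff F1 j : \forall w \near z, j != i -> piece j w.1 w.2 < piece i w.1 w.2.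
  exact: (@filter_forall _ _ _ (nbhs z) _ F1).
have [->|ji] := eqVneq j i; first by near=> w.
have h := hz j ji.
have cj := @lip2_continuous _ _ _ (lip2_piece j) z.
have ci := @lip2_continuous _ _ _ (lip2_piece i) z.
have d0 : 0 < (piece i z.1 z.2 - piece j z.1 z.2) / 2 by lra.
move: ci cj => /cvgrPdist_lt/(_ _ d0) ci /cvgrPdist_lt/(_ _ d0) cj.
apply: filterS2 ci cj => w; rewrite !ltr_norml => /andP[? ?] /andP[? ?] _.
lra.
Unshelve. all: by end_near. Qed.

Lemma measurable_region i : measurable (region i).
Proof. by apply: open_measurable2; exact: open_region. Qed.

Lemma region_near i z : region i z -> exists2 e, 0 < e &
  forall w, `|z.1 - w.1| < e -> `|z.2 - w.2| < e -> region i w.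
Proof.
move=> hz; have /nbhs_ballP[e /= e0 he] : nbhs (z : R * R) (region i).
  by apply: open_nbhs_nbhs; split => //; exact: open_region.
by exists e => // w w1 w2; apply: he; split.
Qed.

Lemma measurable_step a : measurable_fun setT (step a).
Proof.
rewrite /step; apply: measurable_sum => i.
by apply: measurable_funM => //; apply: measurable_indic; exact: measurable_region.
Qed.

Lemma step_bound a z : `|step a z| <= \sum_i `|a i|.
Proof.
rewrite (le_trans (ler_norm_sum _ _ _)) // ler_sum // => i _.
by rewrite normrM indicE ler_piMr // ler_norm_bool.
Qed.

Lemma step_nonpos a x t : t <= 0 -> step a (x, t) = step a (x, 0).
Proof.
move=> t0; rewrite /step; apply: eq_bigr => i _; congr (_ * _).
rewrite !indicE; congr ((nat_of_bool _)%:R); apply/idP/idP; rewrite !inE /region /= /piece.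
  by rewrite maxxx (max_idPr t0).
by rewrite maxxx (max_idPr t0).
Qed.

Lemma region_max z : (forall i j, i != j -> piece i z.1 z.2 != piece j z.1 z.2) ->
  exists i, region i z.
Proof.
move=> h; have [i _ hi] := @bmax_mem _ _ predT ord0 isT (fun i => piece i z.1 z.2).
exists i => j ji; rewrite lt_neqAle h //= -hi.
exact: (@bmax_ub _ _ predT ord0 (fun i => piece i z.1 z.2)).
Qed.

(** The abscissa at which pieces [i] and [j] agree at time [t]; distinct slopes make the quotient
    meaningful. *)
Definition crossing (i j : 'I_m.+1) (t : R) : R :=
  (Num.max t 0 * (theta i - theta j) + (gamma i - gamma j)) / (p i - p j).

Hypothesis A1 : assumptionA1 p.

Lemma piece_eq i j x t : i != j -> piece i x t = piece j x t -> x = crossing i j t.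
Proof.
move=> ij; have pij : p i - p j != 0 by rewrite subr_eq0; exact: A1.
rewrite /piece /crossing => h; apply: (mulIf pij); rewrite divfK //; lra.
Qed.

Lemma ae_region : {ae mu2 R, forall z : plane R, z.2 != 0 /\ exists i, region i z}.
Proof.
have F : {ae mu2 R, forall z : plane R, forall ij : 'I_m.+1 * 'I_m.+1, z.1 != crossing
  ij.1 ij.2 z.2}.
  suff F1 (ij : 'I_m.+1 * 'I_m.+1) : {ae mu2 R, forall z : plane R, z.1 != crossing ij.1
    ij.2 z.2}.
    exact: filter_forall F1.
  apply: ae_not_graph; rewrite /crossing; apply: measurable_funM => //.
  apply: measurable_funD => //; apply: measurable_funM => //.
  exact: measurable_maxr.
apply: filterS2 F (@ae_t_neq0 R) => z h z0; split => //.
apply: region_max => i j ij; apply/negP => /eqP /(piece_eq ij) zc.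
by have := h (i, j); rewrite /= -zc eqxx.
Qed.

Lemma region_off_finite : exists2 E : set R, finite_set E &
  forall x, ~ E x -> exists i, region i (x, 0).
Proof.
exists [set crossing ij.1 ij.2 0 | ij in [set: 'I_m.+1 * 'I_m.+1]].
  exact: finite_image.
move=> x hx; apply: region_max => i j ij; apply/negP => /eqP /(piece_eq ij) /= xc.
by apply: hx; exists (i, j).
Qed.

Lemma fE x t : 0 <= t -> f p theta gamma x t = bmax predT ord0 (fun i => piece i x t).
Proof. by move=> t0; rewrite /f /fmax /bmax /piece (max_idPl t0). Qed.

Lemma f_region i x t : 0 <= t -> region i (x, t) -> f p theta gamma x t = piece i x t.
Proof.
move=> t0 hi; rewrite fE //.
rewrite (@bmax_eq _ _ predT ord0 isT (fun i => piece i x t) i) // => j _.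
by have [->//|/hi/ltW] := eqVneq j i.
Qed.

Lemma selection_region u i x t : gradient_selection p theta gamma u ->
  0 <= t -> region i (x, t) -> u x t = p i.
Proof.
move=> hu t0 hi; have [j hj ->] := hu x t t0.
have [->//|/hi] := eqVneq j i; rewrite /= -(f_region t0 hi) -hj /piece.
by rewrite (max_idPl t0) ltxx.
Qed.

Lemma J_region i x : region i (x, 0) -> derive1 (J p gamma) x = p i.
Proof.
move=> hi; have [e e0 he] := region_near hi.
have E : \forall y \near x, J p gamma y = p i * y - gamma i.
  apply/nbhs_ballP; exists e => // y; rewrite /ball /= => xy.
  have hy : region i (y, 0) by apply: he; rewrite //= subrr normr0.
  have := f_region (lexx 0) hy; rewrite /piece maxxx mul0r subr0 => <-.
  by rewrite /f /J; congr fmax; apply/funext => j; rewrite mul0r subr0.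
rewrite derive1E (near_eq_derive _ E) derive_val.
by rewrite subr0 -[_%:A]/(p i * 1) mulr1.
Qed.

End regions.

(** * The Kruzhkov functional as one integral of step functions *)

Section weak_form.
Variables (R : realType) (m : nat) (p theta gamma : 'I_m.+1 -> R).
Local Notation step := (step p theta gamma).
Local Notation region := (region p theta gamma).
Local Notation piece := (piece p theta gamma).

(** [a] holds the values of an entropy and [b] those of its flux. Only the flux is cut off at t <=
    0: the density term on the lower half-plane is what [dint_boundary] turns into the initial
    condition. *)
Definition weak_form (a b : 'I_m.+1 -> R) (phi : R -> R -> R) : R :=
  dint (fun z => step a z * partial_t phi z.1 z.2 +
    (0 < (z.2 : R))%R%:R * step b z * partial_x phi z.1 z.2).

Lemma tame_step_mul a g : tame g -> tame (fun z => step a z * g z).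
Proof. by apply: tameMl; [exact: measurable_step|exact: step_bound]. Qed.

Lemma tame_gt0_mul (g : plane R -> R) : tame g -> tame (fun z => (0 < (z.2 : R))%R%:R * g
  z).
Proof.
by apply: (@tameMl _ _ _ 1); [exact: measurable_snd_gt0|move=> z; exact: ler_norm_bool].
Qed.

Lemma tame_weak_form a b phi : test_function phi ->
  tame (fun z => step a z * partial_t phi z.1 z.2 +
    (0 < (z.2 : R))%R%:R * step b z * partial_x phi z.1 z.2).
Proof.
move=> tf; have [_ tx tt] := tame_test tf.
apply: tameD; first exact: tame_step_mul.
rewrite (_ : (fun z => _) = (fun z => (0 < (z.2 : R))%R%:R * (step b z * partial_x phi
  z.1 z.2))).
  by apply: tame_gt0_mul; exact: tame_step_mul.
by apply/funext => z; rewrite mulrA.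
Qed.

Lemma step_lin c a a' z : step (fun i => c * a i + a' i) z = c * step a z + step a' z.
Proof.
rewrite /step mulr_sumr -big_split /=; apply: eq_bigr => i _; ring.
Qed.

Lemma weak_form_lin c a b a' b' phi : test_function phi ->
  weak_form (fun i => c * a i + a' i) (fun i => c * b i + b' i) phi =
  c * weak_form a b phi + weak_form a' b' phi.
Proof.
move=> tf; rewrite /weak_form -dint_Z; last exact: tame_weak_form.
rewrite -dint_D; [|by apply: tameZ; exact: tame_weak_form|exact: tame_weak_form].
by congr dint; apply/funext => z; rewrite !step_lin; ring.
Qed.

Lemma measurable_halfplane : measurable (@halfplane R).
Proof.
rewrite (_ : @halfplane R = setT `*` [set` `]0 : R, +oo[]).
  by apply: measurableX => //; exact: measurable_itv.
by apply/seteqP; split => z /=; rewrite /halfplane /= in_itv /= andbT => // -[].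
Qed.

Lemma measurable_sg : measurable_fun setT (Num.sg : R -> R).
Proof.
rewrite (_ : Num.sg = (fun x : R => \1_(`]0, +oo[%classic : set R) x - \1_(`]-oo,
  0[%classic : set R) x)).
  by apply: measurable_funB; apply: measurable_indic; exact: measurable_itv.
apply/funext => x; rewrite !indicE.
rewrite (_ : (x \in `]0, +oo[%classic) = (0 < x)); last by apply/idP/idP; rewrite inE /=
  in_itv /= andbT.
rewrite (_ : (x \in `]-oo, 0[%classic) = (x < 0)); last by apply/idP/idP; rewrite inE /=
  in_itv /=.
by case: sgrP => h; rewrite ?subrr ?subr0 ?sub0r.
Qed.

Hypothesis A1 : assumptionA1 p.

Lemma initial_integral (u0 : R -> R) k phi : test_function phi ->
  (forall i x, region i (x, 0) -> u0 x = p i) ->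
  (\int[mu R]_x (`|u0 x - k|%R * phi x 0%R)%:E =
   \int[mu R]_x (step (fun i => `|p i - k|) (x, 0) * phi x 0)%R%:E)%E.
Proof.
move=> tf hu; have [E fE hE] := region_off_finite theta gamma A1.
have [tp tx tt] := tame_test tf.
have mE : measurable (E : set (measurableTypeR R)).
  by apply: countable_measurable; [move=> x; exact: measurable_set1|exact:
    finite_set_countable].
have mphi : measurable_fun setT (fun x : measurableTypeR R => phi x 0).
  by case: tp => mp _; exact: (measurable_fun_pair1 (f := fun z : plane R => phi z.1 z.2)
    0 mp).
have mstep a : measurable_fun setT (fun x : measurableTypeR R => step a (x, 0)).
  exact: (measurable_fun_pair1 (f := step a) 0 (measurable_step p theta gamma a)).
(* Measurability of [u0] is not assumed: it comes from the agreement with [step p] off the finite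
   set [E], every subset of which is measurable. *)
have mu0 : measurable_fun setT (u0 : measurableTypeR R -> measurableTypeR R).
  rewrite -(setvU E); apply/measurable_funU => //; first exact: measurableC.
  split.
    apply: (@eq_measurable_fun _ _ _ _ _ (fun x : measurableTypeR R => step p (x, 0))).
      by move=> x; rewrite inE => /= /hE[i hi]; rewrite (stepE _ hi) (hu _ _ hi).
    exact: measurable_funTS.
  move=> _ B mB; apply: countable_measurable; first by move=> x; exact: measurable_set1.
  by apply: sub_countable (finite_set_countable fE); apply: subset_card_le => x [].
apply: ae_eq_integral => //.
- apply/measurable_EFinP; apply: measurable_funM => //.
  by apply: measurableT_comp => //; exact: measurable_funB.
- by apply/measurable_EFinP; apply: measurable_funM.
- exists E; split => //.
    by apply: countable_lebesgue_measure0; exact: finite_set_countable.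
  move=> x /= hx; apply: contrapT => /hE[i hi]; apply: hx => _.
  by rewrite (stepE _ hi) (hu _ _ hi).
Qed.

Lemma kruzhkov_weak_form (F u0 : R -> R) (v : R -> R -> R) k phi :
  test_function phi -> continuous F ->
  measurable_fun (@halfplane R) (fun z => v z.1 z.2) ->
  {ae mu2 R, forall z, @halfplane R z -> forall i, region i z -> v z.1 z.2 = p i} ->
  (forall i x, region i (x, 0) -> u0 x = p i) ->
  (\int[mu2 R]_(z in @halfplane R) (entropy_integrand F v phi k z.1 z.2)%:E
        + \int[mu R]_x (`|u0 x - k|%R * phi x 0%R)%:E =
   (weak_form (fun i => `|p i - k|) (fun i => Num.sg (p i - k) * (F (p i) - F k))
     phi)%:E)%E.
Proof.
move=> tf cF mv hv hu; have [tp tx tt] := tame_test tf.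
have [mx mt] := continuous_measurable_partial tf.
rewrite (initial_integral _ tf hu).
set a := fun i => `|p i - k|; set b := fun i => Num.sg _ * _.
have ms c : measurable_fun setT (fun x : R => step c (x, 0)).
  exact: (measurable_fun_pair1 (f := step c) 0 (measurable_step p theta gamma c)).
have [tb <-] := dint_boundary (ms a) (fun x => step_bound _ _ _ a (x, 0)) tf.
pose g (z : plane R) := step a z * partial_t phi z.1 z.2 + step b z * partial_x phi z.1 z.2.
have tg : tame g by apply: tameD; exact: tame_step_mul.
have -> : (\int[mu2 R]_(z in @halfplane R) (entropy_integrand F v phi k z.1 z.2)%:E =
   \int[mu2 R]_(z in @halfplane R) (g z)%:E)%E.
  have mh := measurable_halfplane.
  apply: ae_eq_integral => //.
  - apply/measurable_EFinP; rewrite /entropy_integrand.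
    apply: measurable_funD; apply: measurable_funM; try exact: measurable_funTS.
      by apply: measurableT_comp => //; exact: measurable_funB.
    apply: measurable_funM.
      by apply: (measurableT_comp measurable_sg); exact: measurable_funB.
    apply: measurable_funB => //.
    by apply: (measurableT_comp (continuous_measurable_fun cF)).
  - by apply/measurable_EFinP; apply: measurable_funTS; case: tg.
  - apply: filterS2 hv (ae_region theta gamma A1) => z hz [_ [i hi]] hz0.
    rewrite /entropy_integrand /g /= (hz hz0 i hi) !(stepE _ hi).
    by [].
have tg' := tame_gt0_mul tg.
have -> : (\int[mu2 R]_(z in @halfplane R) (g z)%:E =
   (dint (fun z => (0 < (z.2 : R))%R%:R * g z))%R%:E)%E.
  rewrite /dint /Rintegral fineK; last exact: integrable_fin_num (tame_integrable tg').
  rewrite [LHS]integral_mkcond; congr (integral _ _ _); apply/funext => z; rewrite patchE.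
  case: ifPn => [/set_mem|/negP] h.
    by have -> : (0 < (z.2 : R)) by []; rewrite mul1r.
  by case: (ltP 0 (z.2 : R)) => h'; [exfalso; apply: h; exact/mem_set|rewrite mul0r].
rewrite -EFinD -dint_D //; congr EFin; congr dint; apply/funext => z; rewrite /g.
(* Where t <= 0 the boundary integrand carries the time-zero value of [step a], which is its value
   at [z] because the pieces are frozen there. *)
case: (ltP 0 (z.2 : R)) => h; first by rewrite /=; ring.
rewrite (_ : step a (z.1, 0) = step a z); first by rewrite /=; ring.
by rewrite -(step_nonpos _ _ _ _ z.1 h) -surjective_pairing.
Qed.

End weak_form.

(** * Evaluation of the functional by explicit potentials *)

Section weak_identities.
Variables (R : realType) (m : nat) (p theta gamma : 'I_m.+1 -> R).
Local Notation step := (step p theta gamma).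
Local Notation region := (region p theta gamma).
Local Notation piece := (piece p theta gamma).
Local Notation weak_form := (weak_form p theta gamma).
Hypothesis A1 : assumptionA1 p.

Lemma lip2D M N (W V : R -> R -> R) : lip2 M W -> lip2 N V ->
  lip2 (M + N) (fun x t => W x t + V x t).
Proof.
move=> [M0 hW] [N0 hV]; split => [|x y s t]; first exact: addr_ge0.
rewrite opprD addrACA mulrDl (le_trans (ler_normD _ _)) // lerD //.
Qed.

Lemma lip2Nx k : lip2 `|k| (fun x _ : R => - (k * x)).
Proof.
split => // x y s t.
by rewrite -opprD normrN -mulrBr normrM ler_wpM2l // lerDl.
Qed.

Lemma lip2_max0 M (g : R -> R) : 0 <= M -> (forall s t, `|g s - g t| <= M * `|s - t|) ->
  lip2 M (fun _ t => g (Num.max t 0)).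
Proof.
move=> M0 hg; split => // x y s t; rewrite (le_trans (hg _ _)) // ler_wpM2l //.
by rewrite (le_trans (max0_dist _ _)) // lerDr.
Qed.

Lemma max0_slope (t h : R) : 0 < h < `|t| ->
  Num.max (t + h) 0 = Num.max t 0 + h * (0 < t)%R%:R.
Proof.
move=> /andP[h0]; case: (ltP 0 t) => t0.
  rewrite gtr0_norm // => ht; rewrite !(max_idPl _) ?mulr1 //; lra.
rewrite ler0_norm // => ht; rewrite !(max_idPr _) ?mulr0 ?addr0 //; lra.
Qed.

(** On region [i] the potential [W] has x-derivative [p i - k] and t-derivative [c - theta i] for t
    > 0, zero for t < 0. The functional is then exactly the pairing that [dint_curl] annihilates. *)
Lemma weak_form_affine k c phi : test_function phi ->
  weak_form (fun i => p i - k) (fun i => theta i - c) phi = 0.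
Proof.
move=> tf.
pose W x t := bmax predT ord0 (fun i => piece i x t) + (- (k * x)) + c * Num.max t 0.
have lW : lip2 (pbound p theta + `|k| + `|c|) W.
  apply: lip2D; first apply: lip2D; last 1 first.
  - apply: (@lip2_max0 _ (fun t => c * t)) => // s t.
    by rewrite -mulrBr normrM.
  - apply: lip2_bmax => //; [exact: pbound_ge0|move=> i; exact: lip2_piece].
  - exact: lip2Nx.
have WE i x t : region i (x, t) -> W x t = piece i x t - k * x + c * Num.max t 0.
  move=> hi; rewrite /W (@bmax_eq _ _ predT ord0 isT (fun i => piece i x t) i) // => j _.
  by have [->//|/hi/ltW] := eqVneq j i.
pose B (z : plane R) := (0 < (z.2 : R))%R%:R * step (fun i => c - theta i) z.
have mB : measurable_fun setT B.
  by apply: measurable_funM; [exact: measurable_snd_gt0|exact: measurable_step].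
rewrite -(@dint_curl _ _ phi W (step (fun i => p i - k)) B tf lW) //.
- congr dint; apply/funext => z; rewrite /B.
  have -> : step (fun i => c - theta i) z = - step (fun i => theta i - c) z.
    by rewrite /step -sumrN; apply: eq_bigr => i _; ring.
  by ring.
- exact: measurable_step.
- apply: filterS (ae_region theta gamma A1) => z [z0 [i hi]].
  have [e e0 he] := region_near hi.
  rewrite (stepE _ hi); apply: (@cvg_slope _ (fun x => W x z.2) _ _ e e0) => h /andP[h0 hh].
  have hi' : region i (z.1 + h, z.2).
    by apply: he; rewrite /= ?subrr ?normr0 // opprD addrA subrr sub0r normrN gtr0_norm.
  by rewrite (WE _ _ _ hi') (WE i) -?surjective_pairing // /piece; ring.
- apply: filterS (ae_region theta gamma A1) => z [z0 [i hi]].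
  have [e e0 he] := region_near hi.
  (* The step must remain inside the region and must not cross the kink at t = 0. *)
  have d0 : 0 < Num.min e `|z.2| by rewrite lt_min e0 normr_gt0.
  rewrite /B (stepE _ hi).
  apply: (@cvg_slope _ (fun t => W z.1 t) _ _ _ d0) => h /andP[h0]; rewrite lt_min =>
    /andP[hh hz].
  have hi' : region i (z.1, z.2 + h).
    by apply: he; rewrite /= ?subrr ?normr0 // opprD addrA subrr sub0r normrN gtr0_norm.
  rewrite (WE _ _ _ hi') (WE i) -?surjective_pairing // /piece max0_slope ?h0 //; ring.
Qed.

Section level.
Variables (k : R) (im jp : 'I_m.+1).
Hypotheses (imk : p im <= k) (kjp : k < p jp).

(** Weak on the left and strict on the right: the gap [p q.2 - p q.1] is positive, the left weight
    is never 0, and the split matches the indicator of [k < p i]. *)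
Definition straddle (q : 'I_m.+1 * 'I_m.+1) := (p q.1 <= k) && (k < p q.2).
Definition weight (q : 'I_m.+1 * 'I_m.+1) := (p q.2 - k) / (p q.2 - p q.1).
Definition interp (a : 'I_m.+1 -> R) q := weight q * a q.1 + (1 - weight q) * a q.2.

(* The minimum of sum_i alpha_i (gamma_i + t theta_i) over the alpha in the simplex
   with mean k: the extreme points are supported on pairs straddling k. *)
Definition level_min (t : R) : R := amin straddle (im, jp) (interp gamma) (interp theta) t.

Lemma straddle0 : straddle (im, jp).
Proof. by rewrite /straddle imk. Qed.

Lemma weight_range q : straddle q -> 0 < weight q <= 1.
Proof.
move=> /andP[q1 q2]; have d : 0 < p q.2 - p q.1 by lra.
rewrite /weight; apply/andP; split; first by apply: divr_gt0; lra.
by rewrite ler_pdivrMr //; lra.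
Qed.

Lemma interp_p q : straddle q -> interp p q = k.
Proof.
move=> /andP[q1 q2]; rewrite /interp /weight; field.
by rewrite gt_eqF // subr_gt0; lra.
Qed.

(** The slopes average to [k], so the mean cost of a pair can be read off the values of its two
    pieces at any abscissa [x]. *)
Lemma interp_piece q x t : straddle q ->
  interp gamma q + Num.max t 0 * interp theta q = k * x - interp (fun i => piece i x t) q.
Proof.
by move=> /interp_p <-; rewrite /interp /piece; ring.
Qed.

(** Where u > k this is f - k x minus its minimum over x. Its sign decides whether u > k, so its
    positive part is a potential with x-derivative (u - k)^+. *)
Definition upper x t : R :=
  bmax (fun j => k < p j) jp (fun j => piece j x t) + (- (k * x)) + level_min (Num.max t 0).

(** If the pair [q] attains [level_min], then [upper] is piece [i] minus a weighted mean of the two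
    pieces of [q]. Piece [i] dominates both, strictly so for [q.1], whose weight is positive. *)
Lemma upper_region_gt i x t : region i (x, t) -> k < p i ->
  upper x t = piece i x t - k * x + level_min (Num.max t 0) /\ 0 < upper x t.
Proof.
move=> hi ki.
have E : upper x t = piece i x t - k * x + level_min (Num.max t 0).
  rewrite /upper (@bmax_eq _ _ (fun j => k < p j) jp kjp (fun i => piece i x t) i) // =>
    j _.
  by have [->//|/hi/ltW] := eqVneq j i.
split => //; rewrite E /level_min.
have [q sq ->] := amin_mem straddle0 (interp gamma) (interp theta) (Num.max t 0).
rewrite (interp_piece x) // /interp /=.
have /andP[w0 w1] := weight_range sq; have /andP[q1 q2] := sq.
have h1 : piece q.1 x t < piece i x t.
  by apply: hi; apply/eqP => e; move: q1; rewrite e leNgt ki.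
have h2 : piece q.2 x t <= piece i x t by have [->//|/hi/ltW] := eqVneq q.2 i.
have h3 : 0 < weight q * (piece i x t - piece q.1 x t) by rewrite mulr_gt0 // subr_gt0.
have h4 : 0 <= (1 - weight q) * (piece i x t - piece q.2 x t) by rewrite mulr_ge0 //
  subr_ge0.
by move: h3 h4; move: (piece i x t) (piece _ x t) (piece _ x t) (weight q) => *; lra.
Qed.

(** If [j] attains the maximum in [upper], then testing [level_min] with the pair [(i, j)] gives
    [upper] at most the weight times piece [j] minus piece [i]. *)
Lemma upper_region_le i x t : region i (x, t) -> p i <= k -> upper x t <= 0.
Proof.
move=> hi ki; have [j kj hj] := @bmax_mem _ _ (fun j => k < p j) jp kjp (fun j => piece j
  x t).
have sq : straddle (i, j) by rewrite /straddle ki.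
have := amin_le (im, jp) (interp gamma) (interp theta) (Num.max t 0) sq.
rewrite (interp_piece x) // /upper hj -/(level_min _) /interp /=.
have /andP[w0 w1] := weight_range sq.
have h2 : piece j x t <= piece i x t by have [->//|/hi/ltW] := eqVneq j i.
have h3 : 0 <= weight (i, j) * (piece i x t - piece j x t) by rewrite mulr_ge0 ?subr_ge0
  // ltW.
by move: h3; move: (level_min _) (piece i x t) (piece j x t) (weight _) => *; lra.
Qed.

(** [dh] is the right derivative of [level_min], recorded together with the pair whose line is
    active just after each time. *)
Definition level_slope (dh : R -> R) : Prop :=
  forall t, exists q, [/\ straddle q, dh t = interp theta q,
    level_min t = interp gamma q + t * interp theta q &
    exists2 e, 0 < e &
      forall s, t <= s < t + e -> level_min s = interp gamma q + s * interp theta q].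

Variable dh : R -> R.
Hypotheses (mdh : measurable_fun setT dh) (hdh : level_slope dh).

Definition dh_bound : R := \sum_q `|interp theta q|.

Lemma interp_le q : `|interp theta q| <= dh_bound.
Proof. by rewrite /dh_bound (bigD1 q) //= lerDl sumr_ge0. Qed.

Lemma dh_le t : `|dh t| <= dh_bound.
Proof. by have [q [_ -> _ _]] := hdh t; exact: interp_le. Qed.

Lemma dh_bound_ge0 : 0 <= dh_bound.
Proof. by rewrite sumr_ge0. Qed.

(** Apply [dint_curl] to the positive part of [upper]. Its t-derivative has the part [- theta i] of
    the piece and the part [dh] of the moving level; the second is what survives on the right. *)
Lemma weak_form_level phi : test_function phi ->
  let chi z := (0 < (z.2 : R))%R%:R * (step (fun i => (k < p i)%R%:R) z * dh z.2) in
  weak_form (fun i => (k < p i)%R%:R * (p i - k)) (fun i => (k < p i)%R%:R * theta i) phi =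
  dint (fun z => chi z * partial_x phi z.1 z.2).
Proof.
move=> tf chi; have [tp tx tt] := tame_test tf.
pose W x t := Num.max (upper x t) 0.
have lU : lip2 (pbound p theta + `|k| + dh_bound) upper.
  apply: lip2D; first apply: lip2D; last 1 first.
  - apply: (@lip2_max0 _ level_min); first exact: dh_bound_ge0.
    by move=> s t; apply: (amin_dist straddle0) => q _; exact: interp_le.
  - apply: lip2_bmax => //; [exact: pbound_ge0|move=> i; exact: lip2_piece].
  - exact: lip2Nx.
have lW : lip2 (pbound p theta + `|k| + dh_bound) W.
  case: lU => M0 hU; split => // x y s t.
  by rewrite (le_trans (max0_dist _ _)) //; exact: hU.
have WE i x t : region i (x, t) ->
    W x t = (k < p i)%R%:R * (piece i x t - k * x + level_min (Num.max t 0)).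
  move=> hi; rewrite /W; case: (ltP k (p i)) => ki.
    by have [<- /ltW/max_idPl->] := upper_region_gt hi ki; rewrite mul1r.
  by rewrite mul0r; apply/max_idPr; exact: upper_region_le hi ki.
have mdh2 : measurable_fun setT (fun z : plane R => dh z.2 : R).
  by apply: measurableT_comp.
have mchi : measurable_fun setT chi.
  apply: measurable_funM; first exact: measurable_snd_gt0.
  by apply: measurable_funM => //; exact: measurable_step.
pose B (z : plane R) := chi z -
  (0 < (z.2 : R))%R%:R * step (fun i => (k < p i)%R%:R * theta i) z.
have mB : measurable_fun setT B.
  apply: measurable_funB => //.
  by apply: measurable_funM; [exact: measurable_snd_gt0|exact: measurable_step].
have tchi : tame (fun z => chi z * partial_x phi z.1 z.2).
  rewrite (_ : (fun z => _) = (fun z => (0 < (z.2 : R))%R%:R *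
    (step (fun i => (k < p i)%R%:R) z * (dh z.2 * partial_x phi z.1 z.2)))).
    apply: tame_gt0_mul; apply: tame_step_mul.
    by apply: (@tameMl _ _ _ dh_bound) => // z; exact: dh_le.
  by apply/funext => z; rewrite /chi; ring.
apply/eqP; rewrite -subr_eq0 -dint_B //; last exact: tame_weak_form.
apply/eqP; rewrite -[RHS](@dint_curl _ _ phi W
  (step (fun i => (k < p i)%R%:R * (p i - k))) B tf lW _ mB).
- by congr dint; apply/funext => z; rewrite /B; ring.
- exact: measurable_step.
- apply: filterS (ae_region theta gamma A1) => z [z0 [i hi]].
  have [e e0 he] := region_near hi.
  rewrite (stepE _ hi); apply: (@cvg_slope _ (fun x => W x z.2) _ _ e e0) => h /andP[h0 hh].
  have hi' : region i (z.1 + h, z.2).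
    by apply: he; rewrite /= ?subrr ?normr0 // opprD addrA subrr sub0r normrN gtr0_norm.
  by rewrite (WE _ _ _ hi') (WE i) -?surjective_pairing // /piece; ring.
- apply: filterS (ae_region theta gamma A1) => z [z0 [i hi]].
  have [e e0 he] := region_near hi.
  have [q [sq dq lq [d d0 hd]]] := hdh z.2.
  (* Three constraints on the step: stay in the region, do not cross t = 0, and stay on the affine
     stretch of [level_min]. *)
  have e1 : 0 < Num.min (Num.min e `|z.2|) d by rewrite !lt_min e0 normr_gt0 z0.
  rewrite /B /chi !(stepE _ hi).
  apply: (@cvg_slope _ (fun t => W z.1 t) _ _ _ e1) => h /andP[h0].
  rewrite !lt_min => /andP[/andP[hh hz] hd'].
  have hi' : region i (z.1, z.2 + h).
    by apply: he; rewrite /= ?subrr ?normr0 // opprD addrA subrr sub0r normrN gtr0_norm.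
  rewrite (WE _ _ _ hi') (WE i) -?surjective_pairing // /piece.
  have hm : level_min (Num.max (z.2 + h) 0) =
    level_min (Num.max z.2 0) + h * ((0 < (z.2 : R))%R%:R * dh z.2).
    rewrite max0_slope ?h0 //; case: (ltP 0 (z.2 : R)) => zz /=; last by rewrite mulr0
      mul0r mulr0 !addr0.
    rewrite mulr1 hd ?lq ?dq; first ring.
    by rewrite lerDl ltrD2l hd' andbT ltW.
  rewrite hm max0_slope ?h0 //; ring.
Qed.

End level.

End weak_identities.

(** * Strict convexity of the perturbed data and nonempty regions at small times *)

Section duality.
Variables (R : realType) (m : nat) (p theta gamma : 'I_m.+1 -> R).

Lemma eventually_forall (T : finType) (Q : T -> R -> Prop) :
  (forall i, exists2 e, 0 < e & forall t, 0 < t < e -> Q i t) ->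
  exists2 e, 0 < e & forall t, 0 < t < e -> forall i, Q i t.
Proof.
move=> h; have {}h i : exists e, 0 < e /\ forall t, 0 < t < e -> Q i t.
  by have [e e0 he] := h i; exists e.
have [e he] := choice h.
exists (\big[Num.min/1]_i e i) => [|t /andP[t0 te] i].
  by apply: lt_bigmin => // i _; case: (he i).
case: (he i) => _; apply; rewrite t0 (lt_le_trans te) //.
exact: bigmin_le_cond.
Qed.

Lemma exists_between_strict (T : finType) (P Q : pred T) (a b : T -> R) :
  (forall i j, P i -> Q j -> a i < b j) ->
  exists x, (forall i, P i -> a i < x) /\ (forall j, Q j -> x < b j).
Proof.
move=> h; case: (pickP P) => [i0 Pi0|P0]; case: (pickP Q) => [j0 Qj0|Q0].
- have [i Pi hi] := bmax_mem Pi0 a; have [j Qj hj] := bmax_mem Qj0 (fun j => - b j).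
  exists ((a i + b j) / 2); have := h i j Pi Qj => aibj; split => k hk.
    by have := bmax_ub i0 a hk; rewrite hi; lra.
  by have := bmax_ub j0 (fun j => - b j) hk; rewrite hj; lra.
- exists (bmax P i0 a + 1); split => k; last by rewrite Q0.
  by move=> /(bmax_ub i0 a); lra.
- exists (- bmax Q j0 (fun j => - b j) - 1); split => k; first by rewrite P0.
  by move=> /(bmax_ub j0 (fun j => - b j)); lra.
- by exists 0; split => k; rewrite ?P0 ?Q0.
Qed.

Lemma exists_between (T : finType) (P Q : pred T) (a b : T -> R) :
  (forall i j, P i -> Q j -> a i <= b j) ->
  exists x, (forall i, P i -> a i <= x) /\ (forall j, Q j -> x <= b j).
Proof.
move=> h; case: (pickP P) => [i0 Pi0|P0].
  exists (bmax P i0 a); split => k; first exact: bmax_ub.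
  by move=> Qk; have [i Pi ->] := bmax_mem Pi0 a; exact: h.
case: (pickP Q) => [j0 Qj0|Q0]; last by exists 0; split => k; rewrite ?P0 ?Q0.
exists (- bmax Q j0 (fun j => - b j)); split => k; first by rewrite P0.
by move=> /(bmax_ub j0 (fun j => - b j)); lra.
Qed.

Definition two_point (w : R) (i l : 'I_m.+1) (n : 'I_m.+1) : R :=
  w * (n == i)%:R + (1 - w) * (n == l)%:R.

Lemma sum_delta (i : 'I_m.+1) (g : 'I_m.+1 -> R) : \sum_n (n == i)%:R * g n = g i.
Proof.
rewrite (bigD1 i) //= eqxx mul1r big1 ?addr0 // => n /negbTE ->.
by rewrite mul0r.
Qed.

Lemma sum_two_point w i l (g : 'I_m.+1 -> R) :
  \sum_n two_point w i l n * g n = w * g i + (1 - w) * g l.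
Proof.
under eq_bigr => n _ do rewrite /two_point mulrDl -!mulrA.
by rewrite big_split /= -!mulr_sumr !sum_delta.
Qed.

Lemma simplex_two_point w i l : 0 <= w <= 1 -> simplex (two_point w i l).
Proof.
move=> /andP[w0 w1]; split.
  move=> n; rewrite /two_point; case: (n == i); case: (n == l);
    rewrite ?mulr1 ?mulr0; apply/andP; split; lra.
have := sum_two_point w i l (fun=> 1).
by under eq_bigr do rewrite mulr1; move=> ->; ring.
Qed.

Lemma convex_three_points (i j l : 'I_m.+1) : assumptionA2 p gamma ->
  p i < p j < p l ->
  (p l - p i) * gamma j <= (p l - p j) * gamma i + (p j - p i) * gamma l.
Proof.
move=> [g [cg hg]] /andP[ij jl].
have d : 0 < p l - p i by lra.
pose w := (p l - p j) / (p l - p i).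
have w0 : 0 <= w by apply: divr_ge0; lra.
have w1 : w <= 1 by rewrite ler_pdivrMr //; lra.
have := cg (Itv01 w0 w1) (p i) (p l).
rewrite !inE => /(_ Logic.I Logic.I); rewrite !convRE /= !hg.
have wE : (p l - p i) * w = p l - p j by rewrite /w mulrC divfK // gt_eqF.
rewrite [X in g X <= _](_ : _ = p j); last first.
  transitivity (w * p i + (1 - w) * p l) => //.
  apply: (mulfI (lt0r_neq0 d)); rewrite mulrDr mulrA wE mulrA [(p l - p i) * (1 -
    w)]mulrBr wE; ring.
rewrite hg /unstable.onem => h.
have := ler_wpM2l (ltW d) h; rewrite mulrDr mulrA wE mulrA [(p l - p i) * (1 - w)]mulrBr wE.
by rewrite mulr1 (_ : p l - p i - (p l - p j) = p j - p i) //; ring.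
Qed.

Hypotheses (A1 : assumptionA1 p) (A2 : assumptionA2 p gamma)
  (A3 : assumptionA3 p theta gamma).

(** If the chord inequality for [gamma] is strict, its gap survives a small linear perturbation. If
    it is an equality, (A3) applied to the two-point weights makes the coefficient of [t] strictly
    favourable. *)
Lemma three_points_strict (i j l : 'I_m.+1) : p i < p j < p l ->
  exists2 e, 0 < e & forall t, 0 < t < e ->
  (p l - p i) * (gamma j + t * theta j) <
  (p l - p j) * (gamma i + t * theta i) + (p j - p i) * (gamma l + t * theta l).
Proof.
move=> pijl; have := convex_three_points A2 pijl; have /andP[ij jl] := pijl.
have d : 0 < p l - p i by lra.
rewrite le_eqVlt => /orP[/eqP gE|glt].
  exists 1 => // t /andP[t0 _].
  pose w := (p l - p j) / (p l - p i).
  have wE : (p l - p i) * w = p l - p j by rewrite /w mulrC divfK // gt_eqF.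
  have w0 : 0 <= w by apply: divr_ge0; lra.
  have w1 : w <= 1 by rewrite ler_pdivrMr //; lra.
  have aj : two_point w i l j = 0.
    have /negbTE ji : j != i by apply/eqP => E; move: ij; rewrite E ltxx.
    have /negbTE jl' : j != l by apply/eqP => E; move: jl; rewrite E ltxx.
    by rewrite /two_point ji jl' !mulr0 addr0.
  have S (g : 'I_m.+1 -> R) :
      \sum_(n | n != j) two_point w i l n * g n = w * g i + (1 - w) * g l.
    by rewrite -sum_two_point [RHS](bigD1 j) //= aj mul0r add0r.
  have M (g : 'I_m.+1 -> R) : (p l - p i) * (w * g i + (1 - w) * g l) =
      (p l - p j) * g i + (p j - p i) * g l.
    by rewrite mulrDr mulrA wE mulrA [(p l - p i) * (1 - w)]mulrBr wE; ring.
  have wr : 0 <= w <= 1 by rewrite w0.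
  have := A3 (simplex_two_point i l wr) aj; rewrite !S => /(_ _ _).
  have e1 : w * p i + (1 - w) * p l = p j.
    by apply: (mulfI (lt0r_neq0 d)); rewrite M; ring.
  have e2 : w * gamma i + (1 - w) * gamma l = gamma j.
    by apply: (mulfI (lt0r_neq0 d)); rewrite M gE.
  move=> /(_ e1 e2); rewrite -(ltr_pM2l d) M -(ltr_pM2l t0) => h.
  by move: gE h; lra.
(* [G] is the gap at t = 0 and [D] the rate at which it closes; it stays open for t below
   [G / (|D| + 1)]. *)
set D := (p l - p i) * theta j - ((p l - p j) * theta i + (p j - p i) * theta l).
set G := (p l - p j) * gamma i + (p j - p i) * gamma l - (p l - p i) * gamma j.
have G0 : 0 < G by rewrite subr_gt0.
have D0 : 0 < `|D| + 1 by have := normr_ge0 D; lra.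
exists (G / (`|D| + 1)) => [|t /andP[t0]]; first exact: divr_gt0.
rewrite ltr_pdivlMr // => tG.
have h : t * D <= t * `|D| by rewrite ler_wpM2l ?ler_norm // ltW.
have : t * D < G by move: tG; rewrite mulrDr; lra.
by rewrite /D /G; lra.
Qed.

(** The points [(p i, gamma i + t * theta i)] are in strictly convex position for small [t]. Hence
    all secant slopes arriving at [j] from the left are below those leaving to the right, and any
    [x] strictly between makes piece [j] the strict maximum. *)
Lemma regions_nonempty : exists2 e, 0 < e & forall t, 0 < t < e ->
  forall j, exists x, region p theta gamma j (x, t).
Proof.
have [e e0 he] : exists2 e, 0 < e & forall t, 0 < t < e ->
    forall q : 'I_m.+1 * 'I_m.+1 * 'I_m.+1, p q.1.1 < p q.1.2 < p q.2 ->
    (p q.2 - p q.1.1) * (gamma q.1.2 + t * theta q.1.2) <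
    (p q.2 - p q.1.2) * (gamma q.1.1 + t * theta q.1.1) +
    (p q.1.2 - p q.1.1) * (gamma q.2 + t * theta q.2).
  apply: (@eventually_forall _ (fun q t => p q.1.1 < p q.1.2 < p q.2 -> _)) => q.
  case: (boolP (p q.1.1 < p q.1.2 < p q.2)) => [h|_]; last by exists 1.
  by have [e e0 he] := three_points_strict h; exists e => // t /he.
exists e => // t te j; pose c i := gamma i + t * theta i.
have hc i l : p i < p j -> p j < p l ->
    (c j - c i) / (p j - p i) < (c l - c j) / (p l - p j).
  move=> pij pjl; rewrite ltr_pdivrMr ?subr_gt0 // mulrAC ltr_pdivlMr ?subr_gt0 //.
  by have := he t te (i, j, l); rewrite /= pij pjl => /(_ isT); rewrite /c; lra.
have [x [h1 h2]] := exists_between_strict hc.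
exists x => i ij /=; rewrite /piece (max_idPl _); last by lra.
have := A1 ij; case: (ltgtP (p i) (p j)) => // pij _.
  have := h1 i pij; rewrite ltr_pdivrMr ?subr_gt0 // /c; lra.
have := h2 i pij; rewrite ltr_pdivlMr ?subr_gt0 // /c; lra.
Qed.

End duality.

(** * Values of H by linear programming duality *)

Section effective_hamiltonian.
Variables (R : realType) (m : nat) (p theta gamma : 'I_m.+1 -> R).

Lemma J_ge i x : p i * x - gamma i <= J p gamma x.
Proof. exact: (@bmax_ub _ _ predT ord0 (fun i => p i * x - gamma i)). Qed.

Lemma simplex_ge0 (a : 'I_m.+1 -> R) i : simplex a -> 0 <= a i.
Proof. by case=> /(_ i)/andP[]. Qed.

Lemma conv_hull_domJstar q : conv_hull p q -> domJstar p gamma q.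
Proof.
move=> [a sa aq]; apply: (@le_lt_trans _ _ (\sum_i a i * gamma i)%:E); last exact: ltry.
apply: ge_ereal_sup => _ [x _ <-]; rewrite -EFinB lee_fin -aq.
rewrite lerBlDr -[J p gamma x]mul1r -sa.2 !mulr_suml -big_split /= ler_sum // => i _.
by rewrite -mulrA -mulrDr ler_wpM2l ?(simplex_ge0 i sa) //; have := J_ge i x; lra.
Qed.

Lemma H_minimizer q d : conv_hull p q ->
  (exists2 a, minimizers p gamma q a & \sum_i a i * theta i = d) ->
  (forall a, minimizers p gamma q a -> d <= \sum_i a i * theta i) ->
  H p theta gamma q = d%:E.
Proof.
move=> cq [a ma ad] hd; rewrite /H mem_set; last exact: conv_hull_domJstar.
apply/eqP; rewrite eq_le; apply/andP; split.
  by apply: ereal_inf_lbound; exists a => //; rewrite ad.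
by apply: le_ereal_inf_tmp => _ [b mb <-]; rewrite lee_fin; exact: hd.
Qed.

(** Letting [t] tend to 0 compares intercepts first and slopes only on a tie: the same lexicographic
    order in which H minimizes [gamma], then [theta]. *)
Lemma affine_le_near0 (e u v u' v' : R) : 0 < e ->
  (forall t, 0 < t < e -> u + t * v <= u' + t * v') ->
  u <= u' /\ (u' <= u -> v <= v').
Proof.
move=> e0 h; split => [|uu]; last first.
  have t0 : 0 < e / 2 by lra.
  have : e / 2 * v <= e / 2 * v' by have := h (e / 2) (_ : 0 < e / 2 < e); rewrite t0; lra.
  by rewrite ler_pM2l.
rewrite leNgt; apply/negP => uu; set D := `|v' - v| + 1.
have D0 : 0 < D by have := normr_ge0 (v' - v); rewrite /D; lra.
have g0 : 0 < (u - u') / D by rewrite divr_gt0 // subr_gt0.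
pose t := Num.min (e / 2) ((u - u') / D / 2).
have t0 : 0 < t by rewrite lt_min; apply/andP; split; lra.
have te : t <= e / 2 by rewrite ge_min lexx.
have tg : t <= (u - u') / D / 2 by rewrite ge_min lexx orbT.
have h1 : t * (v' - v) <= t * D by rewrite ler_wpM2l ?(ltW t0) // (le_trans (ler_norm _))
  // lerDl.
have h2 : t * D < u - u' by rewrite -ltr_pdivlMr //; lra.
by have := h t (_ : 0 < t < e); rewrite t0 /=; lra.
Qed.

(** This replaces the nested minimization by a single perturbed linear program: a lower bound valid
    for small [t] and attained at one weight vector identifies both the least [gamma]-cost and the
    least [theta]-cost among its minimizers. *)
Lemma H_affine_bound q e c d : conv_hull p q -> 0 < e ->
  (forall a, simplex a -> \sum_i a i * p i = q -> forall t, 0 < t < e ->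
    c + t * d <= \sum_i a i * (gamma i + t * theta i)) ->
  (exists a, [/\ simplex a, \sum_i a i * p i = q, \sum_i a i * gamma i = c &
     \sum_i a i * theta i = d]) ->
  H p theta gamma q = d%:E.
Proof.
move=> cq e0 h [a0 [sa0 a0q a0c a0d]].
have h' a : simplex a -> \sum_i a i * p i = q ->
    c <= \sum_i a i * gamma i /\ (\sum_i a i * gamma i <= c -> d <= \sum_i a i * theta i).
  move=> sa aq; apply: (affine_le_near0 e0) => t te.
  rewrite (le_trans (h a sa aq t te)) // mulr_sumr -big_split /= ler_sum // => i _.
  by rewrite mulrDr mulrCA.
apply: H_minimizer => //.
  by exists a0 => //; split => // b sb bq; rewrite a0c; case: (h' b sb bq).
move=> a [sa aq am]; apply: (h' a sa aq).2.
by rewrite -a0c; exact: am.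
Qed.

Lemma conv_hull_node j : conv_hull p (p j).
Proof.
exists (two_point 1 j j); first by apply: simplex_two_point; rewrite ler01 lexx.
by rewrite sum_two_point; ring.
Qed.

(** An abscissa [x] at which piece [j] dominates is the slope of a line through the point of [j]
    lying below all points [(p i, gamma i + t * theta i)]. Averaging that line against [a] certifies
    the lower bound. *)
Lemma H_node j : assumptionA1 p -> assumptionA2 p gamma -> assumptionA3 p theta gamma ->
  H p theta gamma (p j) = (theta j)%:E.
Proof.
move=> A1 A2 A3; have [e e0 he] := regions_nonempty A1 A2 A3.
apply: (@H_affine_bound _ e (gamma j)) => //; first exact: conv_hull_node.
  move=> a sa aj t te; have [x hx] := he t te j; case/andP: (te) => t0 _.
  have hi i : p i * x - (p j * x - (gamma j + t * theta j)) <= gamma i + t * theta i.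
    have [->|/hx] := eqVneq i j; first lra.
    by rewrite /piece /= (max_idPl (ltW t0)); lra.
  have S : \sum_i a i * (p i * x - (p j * x - (gamma j + t * theta j))) = gamma j + t *
    theta j.
    under eq_bigr do rewrite mulrBr mulrA.
    by rewrite sumrB -!mulr_suml aj sa.2; ring.
  by rewrite -S ler_sum // => i _; rewrite ler_wpM2l ?(simplex_ge0 i sa).
exists (two_point 1 j j); split; rewrite ?sum_two_point; try ring.
by apply: simplex_two_point; rewrite ler01 lexx.
Qed.

Section level.
Variables (k : R) (im jp : 'I_m.+1).
Hypotheses (imk : p im <= k) (kjp : k < p jp).
Local Notation level_min := (level_min p theta gamma k im jp).
Local Notation straddle := (straddle p k).
Local Notation interp := (interp p k).

Lemma level_min_le a t : simplex a -> \sum_i a i * p i = k ->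
  level_min t <= \sum_i a i * (gamma i + t * theta i).
Proof.
move=> sa ak; pose c i := gamma i + t * theta i.
have hpair i j : p i <= k -> k < p j ->
    (p j - p i) * level_min t <= (p j - k) * c i + (k - p i) * c j.
  move=> ik kj; have sq : straddle (i, j) by rewrite /straddle ik.
  have d : 0 < p j - p i by lra.
  have := amin_le (im, jp) (interp gamma) (interp theta) t sq.
  rewrite -/(level_min t) -(ler_pM2l d) => /le_trans; apply.
  rewrite /interp /weight /c /= le_eqVlt; apply/orP; left; apply/eqP; field.
  by rewrite gt_eqF.
have hs i j : p i < k -> k < p j ->
    (level_min t - c i) / (k - p i) <= (c j - level_min t) / (p j - k).
  move=> ik kj; rewrite ler_pdivrMr ?subr_gt0 // mulrAC ler_pdivlMr ?subr_gt0 //.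
  by have := hpair i j (ltW ik) kj; lra.
(* A line of slope s through (k, level_min t) lies below all points (p i, c i). *)
have [s [h1 h2]] := exists_between hs.
have hi i : level_min t + s * (p i - k) <= c i.
  case: (ltgtP (p i) k) => pik.
  - by have := h1 i pik; rewrite ler_pdivrMr ?subr_gt0 //; lra.
  - by have := h2 i pik; rewrite ler_pdivlMr ?subr_gt0 //; lra.
  (* A node at [k] itself has no slope quotient; it is compared through the pair [(i, jp)], which
     gives it full weight. *)
  - have := hpair i jp; rewrite pik lexx kjp subrr mul0r addr0 => /(_ isT isT).
    by rewrite ler_pM2l ?subr_gt0 // mulr0 addr0.
have S : \sum_i a i * (level_min t + s * (p i - k)) = level_min t.
  rewrite (eq_bigr (fun i => a i * (level_min t - s * k) + s * (a i * p i))).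
    by rewrite big_split /= -mulr_suml -mulr_sumr ak sa.2; ring.
  by move=> i _; ring.
by rewrite -[leLHS]S ler_sum // => i _; rewrite ler_wpM2l ?(simplex_ge0 i sa).
Qed.

Variable dh : R -> R.
Hypothesis hdh : level_slope p theta gamma k im jp dh.

Lemma conv_hull_level : conv_hull p k.
Proof.
have [q [sq _ _ _]] := hdh 0; have /andP[w0 w1] := weight_range sq.
exists (two_point (weight p k q) q.1 q.2); first by apply: simplex_two_point; rewrite ltW.
by rewrite sum_two_point; exact: interp_p.
Qed.

(** Just after time 0 the perturbed minimum is the affine function of the active pair [q], whose
    two-point weights attain it; its slope is therefore H. *)
Lemma H_level : H p theta gamma k = (dh 0)%:E.
Proof.
have [q [sq dq _ [e e0 he]]] := hdh 0; have /andP[w0 w1] := weight_range sq.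
apply: (@H_affine_bound _ e (interp gamma q)) => //; first exact: conv_hull_level.
  move=> a sa ak t /andP[t0 te].
  have -> : interp gamma q + t * dh 0 = level_min t by rewrite dq he // add0r te ltW.
  exact: level_min_le.
exists (two_point (weight p k q) q.1 q.2); rewrite !sum_two_point; split => //.
  by apply: simplex_two_point; rewrite ltW.
exact: interp_p.
Qed.

(** An exchange argument for concavity: test the minimum at [t] with the pair active at 0 and the
    minimum at 0 with the pair active at [t], then add. *)
Lemma dh_le0 t : 0 < t -> dh t <= dh 0.
Proof.
move=> t0; have [q [sq dq hq _]] := hdh t; have [q0 [sq0 dq0 hq0 _]] := hdh 0.
have := amin_le (im, jp) (interp gamma) (interp theta) t sq0.
have := amin_le (im, jp) (interp gamma) (interp theta) 0 sq.
rewrite -/(level_min 0) -/(level_min t) hq hq0 dq dq0 !mul0r !addr0 => h1 h2.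
by rewrite -(ler_pM2l t0); lra.
Qed.

Lemma dh_small : exists2 e, 0 < e & forall t, 0 <= t < e -> dh t = dh 0.
Proof.
have [q0 [sq0 dq0 _ [e e0 he]]] := hdh 0; exists e => // t /andP[t0 te].
have [q [sq -> hq [d d0 hd]]] := hdh t; rewrite dq0.
(* Within [r] after [t] both affine descriptions of [level_min] are valid, so their increments, and
   hence their slopes, agree. *)
pose r := Num.min (d / 2) ((e - t) / 2).
have r0 : 0 < r by rewrite lt_min; apply/andP; split; lra.
have rd : r <= d / 2 by rewrite ge_min lexx.
have re : r <= (e - t) / 2 by rewrite ge_min lexx orbT.
have h1 := hd (t + r) (_ : t <= t + r < t + d).
have h2 := he (t + r) (_ : 0 <= t + r < 0 + e).
have h3 := he t (_ : 0 <= t < 0 + e).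
apply: (mulfI (lt0r_neq0 r0)).
have -> : r * interp theta q = level_min (t + r) - level_min t.
  by rewrite h1 ?hq; [ring|apply/andP; split; lra].
rewrite h2 ?h3; [ring|apply/andP; split; lra..].
Qed.

End level.

End effective_hamiltonian.

(** * Sign of the functional at a level between two slopes *)

Section sign.
Variables (R : realType) (m : nat) (p theta gamma : 'I_m.+1 -> R).
Local Notation step := (step p theta gamma).
Local Notation region := (region p theta gamma).
Hypothesis A1 : assumptionA1 p.
Variables (k : R) (im jp : 'I_m.+1).
Hypotheses (imk : p im <= k) (kjp : k < p jp).
Local Notation upper := (upper p theta gamma k im jp).

Lemma upper_nondecreasing x y t : x <= y -> upper x t <= upper y t.
Proof.
move=> xy; have [j kj hj] := @bmax_mem _ _ (fun j => k < p j) jp kjp (fun j => piece p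
  theta gamma j x t).
have := @bmax_ub _ _ (fun j => k < p j) jp (fun j => piece p theta gamma j y t) j kj.
rewrite /upper hj.
have : piece p theta gamma j y t = piece p theta gamma j x t + p j * (y - x) by rewrite
  /piece; ring.
have : 0 <= (p j - k) * (y - x) by rewrite mulr_ge0 ?subr_ge0 // ltW.
move: (piece _ _ _ _ _ _) (piece _ _ _ _ _ _) (bmax _ _ _) (level_min _ _ _ _ _ _ _) =>
  *; lra.
Qed.

Lemma step_upper i z : region i z ->
  step (fun i => (k < p i)%R%:R) z = (0 < upper z.1 z.2)%R%:R.
Proof.
move=> hi; rewrite (stepE _ hi).
have hi' : region i (z.1, z.2) by rewrite -surjective_pairing.
case: (ltP k (p i)) => ki; first by have [_ ->] := upper_region_gt imk kjp hi' ki.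
by rewrite ltNge (upper_region_le im kjp hi' ki).
Qed.

(** Minus the distributional x-derivative of a nonincreasing function is a nonnegative measure.
    Discretely, moving the difference quotient from [phi] to [g] pairs the nonnegative [phi] with
    [g (x - h) - g x >= 0]; the limit keeps the sign. *)
Lemma dint_antitone_ge0 (g : plane R -> R) M phi : test_function phi ->
  measurable_fun setT g -> (forall z, `|g z| <= M) ->
  (forall x y t, x <= y -> g (y, t) <= g (x, t)) ->
  0 <= dint (fun z => g z * partial_x phi z.1 z.2).
Proof.
move=> tf mg hg anti; have [N [r [N0 r0 L hb hs]]] := test_function_bounds tf.
have [tp tx tt] := tame_test tf.
have hn0 n : harmonic n != 0 :> R by rewrite /harmonic /= invr_eq0 pnatr_eq0.
pose q n (z : plane R) := g z * ((phi (z.1 + harmonic n) z.2 - phi z.1 z.2) / harmonic n).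
have tq n : tame (q n).
  apply: (tameMl mg hg).
  rewrite (_ : (fun z => _) = (fun z => (harmonic n)^-1 * (phi (z.1 + harmonic n) z.2 -
    phi z.1 z.2))).
    apply: tameZ; apply: tameB => //.
    rewrite (_ : (fun z => _) = (fun z : plane R => phi z.1 z.2) \o shift2 (harmonic n)
      0); first exact: tame_shift.
    by apply/funext => z; rewrite /= addr0.
  by apply/funext => z; rewrite mulrC.
have q0 n : 0 <= dint (q n).
  pose G (z : plane R) := g z * phi (z.1 + harmonic n) z.2.
  pose G' (z : plane R) := g z * phi z.1 z.2.
  have tG : tame G.
    apply: (tameMl mg hg).
    rewrite (_ : (fun z => _) = (fun z : plane R => phi z.1 z.2) \o shift2 (harmonic n)
      0); first exact: tame_shift.
    by apply/funext => z; rewrite /= addr0.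
  have tG' : tame G' by exact: (tameMl mg hg).
  rewrite (_ : q n = (fun z => (harmonic n)^-1 * (G z - G' z))); last first.
    by apply/funext => z; rewrite /q /G /G'; ring.
  rewrite dint_Z; last exact: tameB.
  rewrite mulr_ge0 ?invr_ge0 ?harmonic_ge0 // dint_B // subr_ge0.
  rewrite -(dint_shift (- harmonic n) 0 tG); apply: dint_le => //; first exact: tame_shift.
  move=> z; rewrite /G /G' /= addrNK addr0.
  case: tf => phi0 _ _ _ _; rewrite ler_wpM2r //.
  have := anti (z.1 - harmonic n) z.1 z.2; rewrite -surjective_pairing /shift2 addr0; apply.
  by rewrite gerBl harmonic_ge0.
have M0 : 0 <= M by apply: le_trans (hg (0, 0)).
have cv : (fun n => dint (q n)) @ \oo --> dint (fun z => g z * partial_x phi z.1 z.2).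
  apply: (@dint_cvg _ q _ (M * N) (r + 1)).
  - by move=> n; case: (tq n).
  - by apply: measurable_funM => //; case: tx.
  - move=> n; apply: tame_le => z; split.
      by rewrite normrM ler_pM // (lip2_quot_x _ _ L).
    have hn1 : `|harmonic n : R| <= 1.
      by rewrite ger0_norm ?harmonic_ge0 // /harmonic /= invf_le1 ?ler1n ?ltr0n.
    have T (a : R) : r + 1 < `|a| -> r < `|a| /\ r < `|a + harmonic n|.
      by have := lerB_dist a (- harmonic n); rewrite opprK normrN; lra.
    have S x t : r + 1 < `|x| \/ r + 1 < `|t| -> phi x t = 0 /\ phi (x + harmonic n) t = 0.
      move=> h; split; [have [] // := hs x t|have [] // := hs (x + harmonic n) t];
        case: h => /T[? ?]; tauto.
    move=> /eqP qz; split; apply: contrapT => /negP; rewrite -ltNge => hz; apply: qz.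
      by rewrite /q; case: (S z.1 z.2) => [|-> ->]; [left|ring].
    by rewrite /q; case: (S z.1 z.2) => [|-> ->]; [right|ring].
  - apply: nearW => z; apply: cvgM; first exact: cvg_cst.
    case: tf => _ dphi _ _ _.
    by apply: (cvg_diff_quotient (dphi z.1 z.2).1 hn0); exact: cvg_harmonic.
rewrite -(cvg_lim (@Rhausdorff R) cv); apply: limr_ge; first exact: (cvgP _ cv).
by apply: nearW => n; exact: q0.
Qed.

Lemma lip2_upper : lip2 (pbound p theta + `|k| + dh_bound p theta k) upper.
Proof.
apply: lip2D; first apply: lip2D; last 1 first.
- apply: (@lip2_max0 _ _ (level_min p theta gamma k im jp)); first exact: dh_bound_ge0.
  by move=> s t; apply: (amin_dist (straddle0 imk kjp)) => q _; exact: interp_le.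
- apply: lip2_bmax => //; [exact: pbound_ge0|move=> i; exact: lip2_piece].
- exact: lip2Nx.
Qed.

Lemma measurable_upper : measurable_fun setT (fun z : plane R => (0 < upper z.1 z.2)%R%:R
  : R).
Proof.
have mu := continuous_measurable2 (lip2_continuous lip2_upper).
rewrite (_ : (fun z => _) = \1_[set z : plane R | 0 < upper z.1 z.2]); last first.
  apply/funext => z; rewrite indicE; congr ((nat_of_bool _)%:R).
  by apply/idP/idP; rewrite inE.
apply: measurable_indic; rewrite -[X in measurable X]setTI.
rewrite (_ : setT `&` _ = setT `&` (fun z : plane R => upper z.1 z.2) @^-1` `]0, +oo[).
  by apply: mu => //; exact: measurable_itv.
by apply/seteqP; split => z /= [_ h]; split => //; move: h; rewrite in_itv /= andbT.
Qed.

(** The indicator of u > k is replaced by that of [upper > 0]. The two agree off ties, but only the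
    latter is monotone in x at every point, as [dint_antitone_ge0] requires. *)
Lemma dint_level_ge0 (c : R -> R) M phi : test_function phi ->
  measurable_fun setT c -> (forall t, `|c t| <= M) -> (forall t, 0 < t -> c t <= 0) ->
  0 <= dint (fun z => (0 < (z.2 : R))%R%:R *
     (step (fun i => (k < p i)%R%:R) z * c z.2) * partial_x phi z.1 z.2).
Proof.
move=> tf mc hc c0; have [tp tx tt] := tame_test tf.
have mc2 : measurable_fun setT (fun z : plane R => c z.2 : R) by apply: measurableT_comp.
pose g (z : plane R) := (0 < (z.2 : R))%R%:R * ((0 < upper z.1 z.2)%R%:R * c z.2).
have mg : measurable_fun setT g.
  apply: measurable_funM; first exact: measurable_snd_gt0.
  by apply: measurable_funM => //; exact: measurable_upper.
rewrite (@dint_ae _ _ (fun z => g z * partial_x phi z.1 z.2)).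
- apply: (@dint_antitone_ge0 _ M) => //.
    move=> z; rewrite /g !normrM -[M]mul1r ler_pM // ?ler_norm_bool //.
    by rewrite -[M]mul1r ler_pM // ler_norm_bool.
  move=> x y t xy; rewrite /g /=; case: (ltP 0 t) => t0; last by rewrite !mul0r.
  rewrite !mul1r; have := upper_nondecreasing t xy; have := c0 t t0.
  by case: (ltP 0 (upper x t)) => hx; case: (ltP 0 (upper y t)) => hy; rewrite ?mul1r
    ?mul0r //; lra.
- apply: measurable_funM; last by case: tx.
  apply: measurable_funM; first exact: measurable_snd_gt0.
  by apply: measurable_funM => //; exact: measurable_step.
- by apply: measurable_funM => //; case: tx.
- apply: filterS (ae_region theta gamma A1) => z [z0 [i hi]].
  by rewrite /g (step_upper hi).
Qed.

End sign.

(** * Explicit C^1 test functions *)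

Section bump.
Variable R : realType.

Lemma is_derive_quadratic (f : R -> R) (x d K : R) :
  (forall h, `|f (x + h) - f x - h * d| <= K * h ^+ 2) -> is_derive x 1 f d.
Proof.
move=> hK; have K0 : 0 <= K.
  by have := hK 1; rewrite expr1n mulr1; apply: le_trans.
have cv : h^-1 *: (f (h *: 1 + x) - f x) @[h --> 0^'] --> d.
  apply/cvgrPdist_le => e e0.
  have d0 : 0 < e / (K + 1) by rewrite divr_gt0 //; lra.
  near=> h.
  have h0 : h != 0 by near: h; exact: nbhs_dnbhs_neq.
  have hd : `|h| <= e / (K + 1) by near: h; exact: dnbhs0_le.
  have -> : d - h^-1 *: (f (h *: 1 + x) - f x) = - (f (x + h) - f x - h * d) / h.
    rewrite -[h *: 1]/(h * 1) mulr1 [h + x]addrC -[_ *: _]/(_ * _); field.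
    exact: h0.
  rewrite normrM normrN normfV ler_pdivrMr ?normr_gt0 //.
  apply: le_trans (hK h) _.
  have -> : h ^+ 2 = `|h| * `|h| by rewrite -expr2 real_normK ?num_real.
  rewrite mulrA.
  rewrite ler_wpM2r //; apply: (@le_trans _ _ ((K + 1) * `|h|)).
    by rewrite ler_wpM2r //; lra.
  by rewrite mulrC -ler_pdivlMr //; lra.
apply: DeriveDef; first by apply/cvg_ex; exists d.
exact: (cvg_lim (@Rhausdorff R) cv).
Unshelve. all: by end_near. Qed.

Definition pospart (y : R) := Num.max y 0.

Lemma pos_sq_quadratic (y h : R) :
  `|pospart (y + h) ^+ 2 - pospart y ^+ 2 - 2 * h * pospart y| <= h ^+ 2.
Proof.
rewrite ler_norml !expr2 /pospart.
by case: (leP (y + h) 0) => h1; case: (leP y 0) => h2; apply/andP; split; nra.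
Qed.

(** A second difference of the positive part: the hat function of height [r] supported on
    [[c - r, c + r]]. [ramp] is its C^1 primitive, rising from 0 to [r ^+ 2]. *)
Definition tent (c r x : R) : R := pospart (x - c + r) - 2 * pospart (x - c) + pospart (x
  - c - r).
Definition ramp (c r x : R) : R :=
  (pospart (x - c + r) ^+ 2 - 2 * pospart (x - c) ^+ 2 + pospart (x - c - r) ^+ 2) / 2.

Lemma is_derive_ramp (c r x : R) : is_derive x 1 (ramp c r) (tent c r x).
Proof.
apply: (@is_derive_quadratic _ _ _ 2) => h.
have := pos_sq_quadratic (x - c + r) h.
have := pos_sq_quadratic (x - c) h.
have := pos_sq_quadratic (x - c - r) h.
have E (a : R) : x - c + a + h = x + h - c + a by ring.
have E0 : x - c + h = x + h - c by ring.
rewrite !E E0 /ramp /tent.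
move: (pospart _) (pospart _) (pospart _) (pospart _) (pospart _) (pospart _) => a1 a2 a3
  a4 a5 a6.
by rewrite !ler_norml => /andP[? ?] /andP[? ?] /andP[? ?]; apply/andP; split; lra.
Qed.

Lemma tent_ge0 c r x : 0 <= r -> 0 <= tent c r x.
Proof.
move=> r0; rewrite /tent /pospart.
by case: (leP (x - c + r) 0); case: (leP (x - c) 0); case: (leP (x - c - r) 0); lra.
Qed.

Lemma tent_out c r x : 0 <= r -> r <= `|x - c| -> tent c r x = 0.
Proof.
move=> r0; rewrite ler_normr /tent /pospart => /orP[] h.
  by rewrite !(max_idPl _); lra.
by rewrite !(max_idPr _); lra.
Qed.

Lemma tent_center c r : 0 <= r -> tent c r c = r.
Proof.
move=> r0; rewrite /tent /pospart subrr add0r sub0r maxxx (max_idPl r0) (max_idPr _); lra.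
Qed.

Lemma tent_lipschitz c r x y : `|tent c r x - tent c r y| <= 4 * `|x - y|.
Proof.
have P a b : `|pospart a - pospart b| <= `|a - b| by exact: max0_dist.
have := P (x - c + r) (y - c + r); have := P (x - c) (y - c).
have := P (x - c - r) (y - c - r).
have -> : x - c + r - (y - c + r) = x - y by ring.
have -> : x - c - r - (y - c - r) = x - y by ring.
have -> : x - c - (y - c) = x - y by ring.
rewrite /tent; move: (pospart _) (pospart _) (pospart _) (pospart _) (pospart _) (pospart
  _) => a1 a2 a3 a4 a5 a6.
by rewrite !ler_norml => /andP[? ?] /andP[? ?] /andP[? ?]; apply/andP; split; lra.
Qed.

Lemma ramp_below c r x : 0 <= r -> x <= c - r -> ramp c r x = 0.
Proof. by move=> r0 h; rewrite /ramp /pospart !(max_idPr _) ?expr0n /=; lra. Qed.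

Lemma ramp_above c r x : 0 <= r -> c + r <= x -> ramp c r x = r ^+ 2.
Proof. by move=> r0 h; rewrite /ramp /pospart !(max_idPl _); [field|lra..]. Qed.

Lemma ramp_nondecreasing c r x y : 0 <= r -> x <= y -> ramp c r x <= ramp c r y.
Proof.
move=> r0; rewrite le_eqVlt => /orP[/eqP->//|xy].
have [|||z _ zE] := @MVT R (ramp c r) (tent c r) x y => //.
- by move=> z _; exact: is_derive_ramp.
- apply: derivable_within_continuous => z _.
  by case: (is_derive_ramp c r z).
by rewrite -subr_ge0 zE mulr_ge0 ?tent_ge0 // subr_ge0 ltW.
Qed.

Definition plateau (a b r x : R) : R := ramp a r x - ramp b r x.

Lemma plateau_ge0 a b r x : 0 <= r -> a <= b -> 0 <= plateau a b r x.
Proof.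
move=> r0 ab; rewrite subr_ge0.
have -> : ramp b r x = ramp a r (x - (b - a)).
  by rewrite /ramp (_ : x - (b - a) - a = x - b) //; ring.
by apply: ramp_nondecreasing => //; lra.
Qed.

Lemma plateau_out a b r x : 0 <= r -> a <= b -> x <= a - r \/ b + r <= x ->
  plateau a b r x = 0.
Proof.
move=> r0 ab [h|h]; rewrite /plateau.
  by rewrite !ramp_below ?subrr //; lra.
by rewrite !ramp_above ?subrr //; lra.
Qed.

Lemma is_derive_plateau (a b r x : R) : is_derive x 1 (plateau a b r) (tent a r x - tent
  b r x).
Proof. by apply: is_deriveB; exact: is_derive_ramp. Qed.

Lemma continuous_plateau a b r : continuous (plateau a b r).
Proof.
move=> x; apply: differentiable_continuous; apply/derivable1_diffP.
by case: (is_derive_plateau a b r x).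
Qed.

Lemma continuous_tent c r : continuous (tent c r).
Proof.
move=> x; apply/cvgrPdist_lt => e e0.
have d0 : 0 < e / 4 by lra.
have hb := nbhsx_ballx x _ d0.
near=> y; have : ball x (e / 4) y by near: y; exact: hb.
by rewrite /ball /= => h; have := tent_lipschitz c r x y; lra.
Unshelve. all: by end_near. Qed.

Lemma continuous_mul2 (f g : R -> R) : continuous f -> continuous g ->
  continuous (fun z : R * R => f z.1 * g z.2).
Proof.
move=> cf cg z; apply: continuousM.
  by apply: (@continuous_comp _ _ _ fst f); [exact: cvg_fst|exact: cf].
by apply: (@continuous_comp _ _ _ snd g); [exact: cvg_snd|exact: cg].
Qed.

(** The x-derivative is a positive hat at [a] and a negative one at [b], times a time profile that
    vanishes at distance [2 e] or more from [t]. *)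
Definition bump (a b r t e x s : R) : R := plateau a b r x * plateau (t - e) (t + e) e s.

Lemma bump_partials a b r t e x s :
  [/\ derivable (fun y => bump a b r t e y s) x 1, derivable (fun u => bump a b r t e x
    u) s 1,
  partial_x (bump a b r t e) x s = (tent a r x - tent b r x) * plateau (t - e) (t + e) e s &
  partial_t (bump a b r t e) x s = plateau a b r x * (tent (t - e) e s - tent (t + e) e s)].
Proof.
have Dx : is_derive x 1 (fun y => bump a b r t e y s)
    ((tent a r x - tent b r x) * plateau (t - e) (t + e) e s).
  have := @is_deriveZ _ _ _ (plateau a b r) (plateau (t - e) (t + e) e s) x 1 _
    (is_derive_plateau a b r x).
  rewrite mulrC; congr (is_derive _ _ _ _).
  by apply/funext => y; rewrite /bump mulrC.
have Dt : is_derive s 1 (fun u => bump a b r t e x u)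
    (plateau a b r x * (tent (t - e) e s - tent (t + e) e s)).
  exact: (@is_deriveZ _ _ _ (plateau (t - e) (t + e) e) (plateau a b r x) s 1 _
    (is_derive_plateau _ _ _ s)).
split; [by case: Dx|by case: Dt| |].
- by rewrite /partial_x derive1E; case: Dx.
- by rewrite /partial_t derive1E; case: Dt.
Qed.

Lemma test_function_bump a b r t e : 0 < r -> 0 < e -> a <= b ->
  test_function (bump a b r t e).
Proof.
move=> r0 e0 ab; have te : t - e <= t + e by lra.
split.
- by move=> x s; rewrite mulr_ge0 // plateau_ge0 // ltW.
- by move=> x s; have [dx dt _ _] := bump_partials a b r t e x s; exact: (conj dx dt).
- rewrite (_ : (fun z => _) = (fun z : R * R => (tent a r z.1 - tent b r z.1) * plateau
  (t - e) (t + e) e z.2)).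
    apply: (@continuous_mul2 (fun x => tent a r x - tent b r x)); last exact:
      continuous_plateau.
    by move=> x; apply: continuousB; exact: continuous_tent.
  by apply/funext => z; case: (bump_partials a b r t e z.1 z.2).
- rewrite (_ : (fun z => _) = (fun z : R * R => plateau a b r z.1 * (tent (t - e) e z.2 -
  tent (t + e) e z.2))).
    apply: (@continuous_mul2 _ (fun s => tent (t - e) e s - tent (t + e) e s)); first
      exact: continuous_plateau.
    by move=> x; apply: continuousB; exact: continuous_tent.
  by apply/funext => z; case: (bump_partials a b r t e z.1 z.2).
- pose K : set (R * R) := `[a - r, b + r]%classic `*` `[t - e - e, t + e + e]%classic.
  have cK : compact K by apply: compact_setX; exact: segment_compact.
  have clK : closed K by apply: compact_closed => //; exact: norm_hausdorff.
  apply: (subclosed_compact _ cK); first exact: closed_closure.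
  rewrite [X in _ `<=` X](closure_id K).1 //; apply: closureS => z /=.
  rewrite /bump mulf_eq0 negb_or => /andP[z1 z2]; split; rewrite /= in_itv /=.
    rewrite !leNgt; apply/andP; split; apply: contra z1 => h;
      rewrite (plateau_out (ltW r0) ab) //; [left|right]; lra.
  rewrite !leNgt; apply/andP; split; apply: contra z2 => h;
    rewrite (plateau_out (ltW e0) te) //; [left|right]; lra.
Qed.

Lemma dint_box_gt0 r : 0 < r -> 0 < dint (\1_(box r) : plane R -> R).
Proof.
move=> r0; rewrite /dint /Rintegral integral_indic ?setIT //; last exact: measurable_box.
pose B : set (measurableTypeR R) := `[- r, r]%classic.
rewrite [X in fine X](_ : _ = (mu R B * mu R B)%E); last first.
  by apply: product_measure1E; exact: measurable_itv.
rewrite lebesgue_measure_itv /= lte_fin ifT; last lra.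
by rewrite -EFinB -EFinM /= mulr_gt0 //; lra.
Qed.

Lemma dint_gt0 (g : plane R -> R) (z0 : plane R) e c : tame g -> (forall z, 0 <= g z) ->
  0 < e -> 0 < c -> (forall z, `|z.1 - z0.1| <= e -> `|z.2 - z0.2| <= e -> c <= g z) ->
  0 < dint g.
Proof.
move=> tg g0 e0 c0 hg.
have tB : tame (\1_(box e) : plane R -> R).
  split; first by apply: measurable_indic; exact: measurable_box.
  exists 1, e => z; rewrite indicE; split; first exact: ler_norm_bool.
  by case: (boolP (z \in box e)) => [/set_mem/boxP|]; rewrite ?eqxx.
apply: (@lt_le_trans _ _ (dint (fun z => c * ((\1_(box e) : plane R -> R) \o shift2 (-
  z0.1) (- z0.2)) z))).
  rewrite dint_Z; last exact: tame_shift.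
  by rewrite dint_shift // mulr_gt0 // dint_box_gt0.
apply: dint_le => //; first by apply: tameZ; exact: tame_shift.
move=> z; rewrite /= indicE; case: (boolP (_ \in _)) => [/set_mem/boxP[h1 h2]|_].
  by rewrite mulr1; exact: hg.
by rewrite mulr0.
Qed.

Definition bump_mass (r t e : R) : R :=
  dint (fun z : plane R => tent 0 r z.1 * plateau (t - e) (t + e) e z.2).

Lemma tame_tent_plateau c r t e : 0 < r -> 0 < e ->
  tame (fun z : plane R => tent c r z.1 * plateau (t - e) (t + e) e z.2).
Proof.
move=> r0 e0; have te : t - e <= t + e by lra.
have cg := continuous_mul2 (@continuous_tent c r) (@continuous_plateau (t - e) (t + e) e).
have Z x s : `|c| + r + `|t| + 2 * e < `|x| \/ `|c| + r + `|t| + 2 * e < `|s| ->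
    tent c r x * plateau (t - e) (t + e) e s = 0.
  have c0 := normr_ge0 c; have t0 := normr_ge0 t.
  move=> [h|h].
    rewrite tent_out ?mul0r //; first exact: ltW.
    by have := lerB_dist x c; lra.
  rewrite plateau_out ?mulr0 //; first exact: ltW.
  move: h; rewrite lter_normr => /orP[] h; have := ler_norm t; have := ler_norm (- t).
    by rewrite normrN; right; lra.
  by rewrite normrN; left; lra.
have [M hM] := continuous_bounded_support cg Z.
split; first exact: continuous_measurable2.
exists M, (`|c| + r + `|t| + 2 * e) => z; split; first exact: hM.
move=> z0; split; rewrite leNgt; apply: contra z0 => h; rewrite Z //; first by left.
by right.
Qed.

Lemma bump_mass_gt0 r t e : 0 < r -> 0 < e -> 0 < bump_mass r t e.
Proof.
move=> r0 e0; have te : t - e <= t + e by lra.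
have cg := continuous_mul2 (@continuous_tent 0 r) (@continuous_plateau (t - e) (t + e) e).
pose g (z : R * R) := tent 0 r z.1 * plateau (t - e) (t + e) e z.2.
have g0 : g (0, t) = r * e ^+ 2.
  rewrite /g /= tent_center ?(ltW r0) // /plateau.
  have -> : ramp (t - e) e t = e ^+ 2 by apply: ramp_above; lra.
  have -> : ramp (t + e) e t = 0 by apply: ramp_below; lra.
  by rewrite subr0.
have gp : 0 < g (0, t) by rewrite g0 mulr_gt0 // exprn_gt0.
have gp2 : 0 < g (0, t) / 2 by lra.
have /cvgrPdist_lt/(_ _ gp2)/nbhs_ballP[d /= d0 hd] := cg (0, t).
apply: (@dint_gt0 g (0, t) (d / 2) (g (0, t) / 2)) => //; last 2 first.
- by lra.
- move=> z h1 h2; have := hd z; rewrite -/(g (0, t)) -/(g z) => /(_ _).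
  have hz : ball ((0, t) : R * R) d z.
    by split; rewrite /ball /= distrC; [move: h1|move: h2]; rewrite /=; lra.
  by move=> /(_ hz); rewrite ltr_norml => /andP[? ?]; lra.
- exact: tame_tent_plateau.
- by move=> z; rewrite mulr_ge0 ?tent_ge0 ?plateau_ge0 // ltW.
Qed.

(** The x-derivative of the bump lives near the two points only, so the values of [g] between them
    do not matter. By translation invariance both hats have the same mass. *)
Lemma dint_bump (g : plane R -> R) (M a b r t e c1 c2 : R) :
  0 < r -> 0 < e -> measurable_fun setT g -> (forall z, `|g z| <= M) ->
  (forall z, `|z.1 - a| < r -> `|z.2 - t| < 2 * e -> g z = c1) ->
  (forall z, `|z.1 - b| < r -> `|z.2 - t| < 2 * e -> g z = c2) ->
  dint (fun z => g z * partial_x (bump a b r t e) z.1 z.2) = (c1 - c2) * bump_mass r t e.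
Proof.
move=> r0 e0 mg hg h1 h2; have te : t - e <= t + e by lra.
pose T c (z : plane R) := tent c r z.1 * plateau (t - e) (t + e) e z.2.
have tT c : tame (T c) by exact: tame_tent_plateau.
have IT c : dint (T c) = bump_mass r t e.
  rewrite /bump_mass -(dint_shift (- c) 0 (tT 0)); congr dint; apply/funext => z.
  by rewrite /T /= addr0 /tent subr0.
have gT c d : (forall z, `|z.1 - c| < r -> `|z.2 - t| < 2 * e -> g z = d) ->
    forall z, g z * T c z = d * T c z.
  move=> h z; case: (ltP `|z.1 - c| r) => z1; last first.
    by rewrite /T tent_out ?mul0r ?mulr0 // ltW.
  case: (ltP `|z.2 - t| (2 * e)) => z2; first by rewrite h.
  rewrite /T (plateau_out (ltW e0) te) ?mulr0 //.
  by move: z2; rewrite ler_normr => /orP[] ?; [right|left]; lra.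
rewrite (_ : (fun z => _) = (fun z => c1 * T a z - c2 * T b z)).
  rewrite dint_B ?dint_Z ?IT //; [by ring|exact: tameZ..].
apply/funext => z; rewrite -(gT a c1) // -(gT b c2) //.
have [_ _ -> _] := bump_partials a b r t e z.1 z.2.
by rewrite /T; ring.
Qed.

End bump.

(** * Sufficiency of the flux condition *)

Section entropy.
Variables (R : realType) (m : nat) (p theta gamma : 'I_m.+1 -> R).
Local Notation step := (step p theta gamma).
Local Notation region := (region p theta gamma).
Local Notation weak_form := (weak_form p theta gamma).
Hypothesis A1 : assumptionA1 p.

Lemma weak_form0 b phi :
  weak_form (fun=> 0) b phi =
  dint (fun z => (0 < (z.2 : R))%R%:R * step b z * partial_x phi z.1 z.2).
Proof.
congr dint; apply/funext => z.
have -> : step (fun=> 0) z = 0 by apply: big1 => i _; rewrite mul0r.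
by rewrite mul0r add0r.
Qed.

Lemma eq_weak_form a a' b b' phi : a =1 a' -> b =1 b' ->
  weak_form a b phi = weak_form a' b' phi.
Proof. by move=> /funext -> /funext ->. Qed.

Lemma weak_formN a b phi : test_function phi ->
  weak_form (fun i => - a i) (fun i => - b i) phi = - weak_form a b phi.
Proof.
(* The combination [- 2 * a + a] produces the opposite from [weak_form_lin] without a separate
   evaluation at zero. *)
move=> tf; have := weak_form_lin p theta gamma (- 2) a b a b tf.
rewrite (_ : (fun i => -2 * a i + a i) = (fun i => - a i)); last by apply/funext => i; ring.
rewrite (_ : (fun i => -2 * b i + b i) = (fun i => - b i)); last by apply/funext => i; ring.
by move=> ->; ring.
Qed.

Lemma norm_split (x : R) : `|x| = 2 * ((0 < x)%R%:R * x) - x.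
Proof. by case: (ltrgt0P x) => [h|h|->] /=; ring. Qed.

Lemma sg_split (x : R) : x != 0 -> Num.sg x = 2 * (0 < x)%R%:R - 1.
Proof.
by case: (ltrgt0P x) => // h _; rewrite /= ?(gtr0_sg h) ?(ltr0_sg h); ring.
Qed.

(** Write |u - k| as 2 (u - k)^+ - (u - k). The affine half contributes nothing by
    [weak_form_affine]; the positive part is given by [weak_form_level], and the flux constant
    [C - F k] multiplies the indicator of u > k. *)
Lemma weak_form_kruzhkov_level F C k im jp dh phi : test_function phi ->
  (forall i, F (p i) = theta i + C) -> p im <= k -> k < p jp ->
  measurable_fun setT dh ->
  level_slope p theta gamma k im jp dh ->
  weak_form (fun i => `|p i - k|) (fun i => Num.sg (p i - k) * (F (p i) - F k)) phi =
  2 * dint (fun z => (0 < (z.2 : R))%R%:R *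
    (step (fun i => (k < p i)%R%:R) z * (dh z.2 + (C - F k))) * partial_x phi z.1 z.2).
Proof.
move=> tf hF imk kjp mdh hdh; have [tp tx tt] := tame_test tf.
pose chi i : R := (k < p i)%R%:R.
rewrite (_ : (fun i => `|p i - k|) = (fun i => 2 * (chi i * (p i - k)) + - (p i - k)));
  last first.
  by apply/funext => i; rewrite norm_split subr_gt0.
rewrite (_ : (fun i => Num.sg _ * _) =
    (fun i => 2 * (chi i * theta i + (C - F k) * chi i) + - (theta i - (F k - C)))); last
      first.
  (* At a slope equal to [k] the sign is 0; the right side vanishes too, because [F k] is then
     [theta i + C]. *)
  apply/funext => i; rewrite /chi hF; have [pk|pk] := eqVneq (p i) k.
    by rewrite -pk hF subrr sgr0 ltxx; ring.
  by rewrite sg_split ?subr_eq0 // subr_gt0; ring.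
rewrite weak_form_lin // weak_formN // weak_form_affine // oppr0 addr0; congr (2 * _).
have -> : weak_form (fun i => chi i * (p i - k)) (fun i => chi i * theta i + (C - F k) *
  chi i) phi =
    weak_form (fun i => chi i * (p i - k)) (fun i => chi i * theta i) phi +
    (C - F k) * weak_form (fun=> 0) chi phi.
  rewrite [RHS]addrC -(weak_form_lin _ _ _ (C - F k) (fun=> 0) chi _ (fun i => chi i *
    theta i) tf); apply: eq_weak_form => i.
    by rewrite mulr0 add0r.
  by rewrite addrC.
rewrite (weak_form_level A1 imk kjp mdh hdh tf) weak_form0.
have mdh2 : measurable_fun setT (fun z : plane R => dh z.2 : R) by apply: measurableT_comp.
have tc : tame (fun z => (0 < (z.2 : R))%R%:R * step chi z * partial_x phi z.1 z.2).
  rewrite (_ : (fun z => _) = (fun z => (0 < (z.2 : R))%R%:R * (step chi z * partial_x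
    phi z.1 z.2))).
    by apply: tame_gt0_mul; exact: tame_step_mul.
  by apply/funext => z; rewrite mulrA.
rewrite -dint_Z // -dint_D.
- by congr dint; apply/funext => z; rewrite /chi; ring.
- rewrite (_ : (fun z => _) = (fun z => (0 < (z.2 : R))%R%:R *
    (step chi z * (dh z.2 * partial_x phi z.1 z.2)))).
    apply: tame_gt0_mul; apply: tame_step_mul.
    by apply: (@tameMl _ _ _ (dh_bound p theta k)) => // z; exact: (dh_le hdh).
  by apply/funext => z; rewrite /chi; ring.
- exact: tameZ.
Qed.

Lemma level_slope_exists k im jp : p im <= k -> k < p jp ->
  exists dh : R -> R, measurable_fun setT dh /\ level_slope p theta gamma k im jp dh.
Proof. by move=> imk kjp; exact: (amin_slope (straddle0 imk kjp)). Qed.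

(* Outside the range of p the Kruzhkov entropies are affine. *)
Lemma weak_form_kruzhkov_below F k phi : (forall i, k < p i) ->
  weak_form (fun i => `|p i - k|) (fun i => Num.sg (p i - k) * (F (p i) - F k)) phi =
  weak_form (fun i => p i - k) (fun i => F (p i) - F k) phi.
Proof.
move=> hk; apply: eq_weak_form => i; have h := hk i.
  by rewrite gtr0_norm // subr_gt0.
by rewrite gtr0_sg ?mul1r // subr_gt0.
Qed.

Lemma weak_form_kruzhkov_above F k phi : test_function phi -> (forall i, p i <= k) ->
  weak_form (fun i => `|p i - k|) (fun i => Num.sg (p i - k) * (F (p i) - F k)) phi =
  - weak_form (fun i => p i - k) (fun i => F (p i) - F k) phi.
Proof.
move=> tf hk; rewrite -weak_formN //.
apply: eq_weak_form => i; have := hk i.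
  by rewrite -subr_le0 => /ler0_norm.
rewrite le_eqVlt => /orP[/eqP->|h]; first by rewrite !subrr mulr0 oppr0.
by rewrite ltr0_sg ?mulN1r // subr_lt0.
Qed.

Lemma kruzhkov_step F C : continuous F -> (forall i, F (p i) = theta i + C) ->
  (forall q, conv_hull p q -> (H p theta gamma q + C%:E <= (F q)%:E)%E) ->
  kruzhkov F (derive1 (J p gamma)) (fun x t => step p (x, t)).
Proof.
move=> cF hF hH k phi tf; have [tp tx tt] := tame_test tf.
rewrite (@kruzhkov_weak_form _ _ p theta gamma A1 F (derive1 (J p gamma)) _ k phi tf cF).
- rewrite lee_fin.
  case: (pickP (fun i => p i <= k)) => [im imk|noim]; last first.
    have hk i : k < p i by rewrite ltNge noim.
    rewrite weak_form_kruzhkov_below //.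
    rewrite (_ : (fun i => F (p i) - F k) = (fun i => theta i - (F k - C))).
      by rewrite weak_form_affine.
    by apply/funext => i; rewrite hF; ring.
  case: (pickP (fun i => k < p i)) => [jp kjp|nojp]; last first.
    have hk i : p i <= k by rewrite leNgt nojp.
    rewrite weak_form_kruzhkov_above //.
    rewrite (_ : (fun i => F (p i) - F k) = (fun i => theta i - (F k - C))).
      by rewrite weak_form_affine // oppr0.
    by apply/funext => i; rewrite hF; ring.
  have [dh [mdh hdh]] := level_slope_exists imk kjp.
  rewrite (weak_form_kruzhkov_level tf hF imk kjp mdh hdh) mulr_ge0 //.
  apply: (@dint_level_ge0 _ _ _ _ _ A1 _ _ _ imk kjp (fun t => dh t + (C - F k))
     (dh_bound p theta k + `|C - F k|)) => //.
  + exact: measurable_funD.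
  + by move=> t; rewrite (le_trans (ler_normD _ _)) // lerD // (dh_le hdh).
  + move=> t t0; have := dh_le0 hdh t0.
    have := hH k (conv_hull_level hdh); rewrite (H_level kjp hdh) -EFinD lee_fin; lra.
- apply: measurable_funTS; rewrite (_ : (fun z => _) = step p); first exact:
  measurable_step.
  by apply/funext => z; rewrite -surjective_pairing.
- by apply: nearW => z _ i hi; rewrite -surjective_pairing (stepE _ hi).
- by move=> i x hi; exact: J_region hi.
Qed.

Lemma entropy_solution_step F C u : gradient_selection p theta gamma u ->
  continuous F -> (forall i, F (p i) = theta i + C) ->
  (forall q, conv_hull p q -> (H p theta gamma q + C%:E <= (F q)%:E)%E) ->
  entropy_solution F (derive1 (J p gamma)) u.
Proof.
move=> hu cF hF hH; exists (fun x t => step p (x, t)); split.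
- apply: measurable_funTS; rewrite (_ : (fun z => _) = step p); first exact:
  measurable_step.
  by apply/funext => z; rewrite -surjective_pairing.
- by exists (\sum_i `|p i|) => x t _; exact: step_bound.
- apply: filterS (ae_region theta gamma A1) => z [_ [i hi]] z0.
  rewrite -surjective_pairing (stepE _ hi).
  by apply: (selection_region hu); [exact: ltW|rewrite -surjective_pairing].
- exact: kruzhkov_step hF hH.
Qed.

End entropy.

Lemma locally_lipschitz_continuous (R : realType) (F : R -> R) :
  locally_lipschitz F -> continuous F.
Proof.
move=> lF x; have [U Ux /pinfty_ex_gt0[M M0 hM]] := lF x.
apply/cvgrPdist_lt => e e0.
have d0 : 0 < e / M by rewrite divr_gt0.
have hb := nbhsx_ballx x _ d0.
near=> y.
have Uy : U y by near: y.
have xy : ball x (e / M) y by near: y; exact: hb.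
apply: (@le_lt_trans _ _ (M * `|x - y|)).
  by apply: (hM (x, y)); split => //=; exact: nbhs_singleton.
by rewrite mulrC -ltr_pdivlMr.
Unshelve. all: by end_near. Qed.

(** * Necessity of the flux condition *)

Section necessity.
Variables (R : realType) (m : nat) (p theta gamma : 'I_m.+1 -> R).
Local Notation step := (step p theta gamma).
Local Notation region := (region p theta gamma).
Local Notation weak_form := (weak_form p theta gamma).
Hypotheses (A1 : assumptionA1 p) (A2 : assumptionA2 p gamma)
  (A3 : assumptionA3 p theta gamma).

(** One pair of sizes serves both points. The horizon [T] also caps the times in the boxes, to keep
    them where [dh] is constant. *)
Lemma region_boxes i j (a b t T : R) : region i (a, t) -> region j (b, t) ->
  0 < t -> 0 < T -> exists r e, [/\ 0 < r, 0 < e,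
    forall z, `|z.1 - a| < r -> `|z.2 - t| < 2 * e -> region i z /\ 0 < z.2 < t + T &
    forall z, `|z.1 - b| < r -> `|z.2 - t| < 2 * e -> region j z /\ 0 < z.2 < t + T].
Proof.
move=> ia jb t0 T0; have [e1 e10 h1] := region_near ia; have [e2 e20 h2] := region_near jb.
pose r := Num.min (Num.min e1 e2) (Num.min t T).
have r0 : 0 < r by rewrite !lt_min e10 e20 t0 T0.
have re1 : r <= e1 by rewrite !ge_min lexx.
have re2 : r <= e2 by rewrite !ge_min lexx orbT.
have rt : r <= t by rewrite !ge_min lexx !orbT.
have rT : r <= T by rewrite !ge_min lexx !orbT.
have S (s : R) : `|s - t| < 2 * (r / 2) -> 0 < s < t + T.
  by rewrite ltr_norml => /andP[? ?]; apply/andP; split; lra.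
exists r, (r / 2); split => // [|z z1 z2|z z1 z2]; first lra.
- split; last exact: S.
  by apply: h1; rewrite /= distrC; lra.
- split; last exact: S.
  by apply: h2; rewrite /= distrC; lra.
Qed.

Variables (u : R -> R -> R) (F : R -> R).
Hypotheses (hu : gradient_selection p theta gamma u) (cF : continuous F)
  (sol : entropy_solution F (derive1 (J p gamma)) u).

Lemma weak_form_kruzhkov_ge0 k phi : test_function phi ->
  0 <= weak_form (fun i => `|p i - k|) (fun i => Num.sg (p i - k) * (F (p i) - F k)) phi.
Proof.
move=> tf; have [v [mv _ hv kv]] := sol.
have := kv k phi tf.
rewrite (@kruzhkov_weak_form _ _ p theta gamma A1 F (derive1 (J p gamma)) _ k phi tf cF) //.
- apply: filterS hv => z hz z0 i hi; rewrite -hz //.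
  by apply: (selection_region hu); [exact: ltW|rewrite -surjective_pairing].
- by move=> i x hi; exact: J_region hi.
Qed.

Lemma weak_form_rankine_hugoniot k phi : test_function phi ->
  weak_form (fun i => p i - k) (fun i => F (p i) - F k) phi =
  weak_form (fun=> 0) (fun i => F (p i) - theta i) phi.
Proof.
move=> tf; have := weak_form_lin p theta gamma 1 (fun=> 0) (fun i => F (p i) - theta i)
  (fun i => p i - k) (fun i => theta i - F k) tf.
rewrite weak_form_affine // addr0 [RHS]mul1r => <-.
by apply: eq_weak_form => i; ring.
Qed.

(** Constants [k] above and below all slopes give the same linear functional with opposite signs, so
    the two entropy inequalities force equality. *)
Lemma rankine_hugoniot phi : test_function phi ->
  weak_form (fun=> 0) (fun i => F (p i) - theta i) phi = 0.
Proof.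
move=> tf; have pb i : `|p i| <= pbound p theta by case: (pbound_ge p theta i).
apply/eqP; rewrite eq_le; apply/andP; split.
- have hk i : p i <= pbound p theta by rewrite (le_trans (ler_norm _)).
  have := weak_form_kruzhkov_ge0 (pbound p theta) tf.
  by rewrite weak_form_kruzhkov_above // oppr_ge0 weak_form_rankine_hugoniot.
(* The extra 1 gives strict inequality, which the lower case needs and the upper case does not. *)
- have hk i : - (pbound p theta) - 1 < p i.
    by have := pb i; rewrite ler_norml => /andP[? _]; lra.
  have := weak_form_kruzhkov_ge0 (- (pbound p theta) - 1) tf.
  by rewrite weak_form_kruzhkov_below // weak_form_rankine_hugoniot.
Qed.

(** For t > 0, F(u) minus the [theta] of the active piece has zero distributional x-derivative. A
    bump between the two points compares its values there, whether or not the regions are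
    adjacent. *)
Lemma jump_eq i j (a b t : R) : region i (a, t) -> region j (b, t) -> 0 < t -> a <= b ->
  F (p i) - theta i = F (p j) - theta j.
Proof.
move=> ia jb t0 ab; have [r [e [r0 e0 h1 h2]]] := region_boxes ia jb t0 ltr01.
have := rankine_hugoniot (test_function_bump t r0 e0 ab).
pose d i := F (p i) - theta i.
rewrite weak_form0.
rewrite (@dint_bump _ (fun z => (0 < (z.2 : R))%R%:R * step d z) (\sum_i `|d i|)
  _ _ _ _ _ (d i) (d j)) //.
- move/eqP; rewrite mulf_eq0 subr_eq0 => /orP[/eqP //|].
  by rewrite gt_eqF // bump_mass_gt0.
- by apply: measurable_funM; [exact: measurable_snd_gt0|exact: measurable_step].
- move=> z; rewrite normrM -[leRHS]mul1r ler_pM ?ler_norm_bool //; exact: step_bound.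
- by move=> z z1 z2; have [hz /andP[-> _]] := h1 z z1 z2; rewrite (stepE _ hz) mul1r.
- by move=> z z1 z2; have [hz /andP[-> _]] := h2 z z1 z2; rewrite (stepE _ hz) mul1r.
Qed.

Lemma flux_nodes i : F (p i) = theta i + (F (p ord0) - theta ord0).
Proof.
have [e e0 he] := regions_nonempty A1 A2 A3.
have t0 : 0 < e / 2 by lra.
have te : 0 < e / 2 < e by rewrite t0; lra.
have [a ha] := he _ te i; have [b hb] := he _ te ord0.
case: (leP a b) => ab; first by have := jump_eq ha hb t0 ab; lra.
by have := jump_eq hb ha t0 (ltW ab); lra.
Qed.

(** At a small time both a region with slope at most [k] and one with slope above [k] are present,
    and [dh] still equals [dh 0]. A bump from the first to the second isolates [dh 0 + (C - F k)]
    with a negative factor. *)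
Lemma flux_above k im jp : p im <= k -> k < p jp ->
  (H p theta gamma k + (F (p ord0) - theta ord0)%:E <= (F k)%:E)%E.
Proof.
move=> imk kjp; set C := F (p ord0) - theta ord0.
have [dh [mdh hdh]] := level_slope_exists theta gamma imk kjp.
rewrite (H_level kjp hdh) -EFinD lee_fin.
have [e1 e10 he1] := regions_nonempty A1 A2 A3.
have [e2 e20 he2] := dh_small hdh.
(* Half of the minimum: the boxes reach times up to [t + t], which must not exceed [e2]. *)
pose t := Num.min e1 e2 / 2.
have m0 : 0 < Num.min e1 e2 by rewrite lt_min e10.
have t0 : 0 < t by rewrite /t; lra.
have te1 : Num.min e1 e2 <= e1 by rewrite ge_min lexx.
have te2 : Num.min e1 e2 <= e2 by rewrite ge_min lexx orbT.
have tt1 : 0 < t < e1 by rewrite t0 /t; lra.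
have [a ha] := he1 t tt1 im; have [b hb] := he1 t tt1 jp.
(* [upper] is nondecreasing in x, nonpositive at [a] and positive at [b], so the two points are in
   this order. *)
have ab : a <= b.
  rewrite leNgt; apply/negP => /ltW ba.
  have := upper_nondecreasing theta gamma im kjp t ba.
  have := upper_region_le im kjp ha imk.
  by have [_] := upper_region_gt imk kjp hb kjp; lra.
have [r [e [r0 e0 h1 h2]]] := region_boxes ha hb t0 t0.
have tf := test_function_bump t r0 e0 ab.
have := weak_form_kruzhkov_ge0 k tf.
rewrite (weak_form_kruzhkov_level A1 tf flux_nodes imk kjp mdh hdh) -/C.
pose chi i : R := (k < p i)%R%:R.
have mdh2 : measurable_fun setT (fun z : plane R => dh z.2 : R) by apply: measurableT_comp.
rewrite (@dint_bump _ (fun z => (0 < (z.2 : R))%R%:R * (step chi z * (dh z.2 + (C - F k))))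
  ((\sum_i `|chi i|) * (dh_bound p theta k + `|C - F k|)) _ _ _ _ _ 0 (dh 0 + (C - F k)))
    //.
- have mass := bump_mass_gt0 t r0 e0.
  by rewrite pmulr_rge0 // pmulr_lge0 //; lra.
- apply: measurable_funM; first exact: measurable_snd_gt0.
  by apply: measurable_funM; [exact: measurable_step|exact: measurable_funD].
- move=> z; rewrite normrM -[leRHS]mul1r ler_pM ?ler_norm_bool // normrM ler_pM //.
    exact: step_bound.
  by rewrite (le_trans (ler_normD _ _)) // lerD // (dh_le hdh).
- move=> z z1 z2; have [hz _] := h1 z z1 z2.
  by rewrite (stepE _ hz) /chi [k < _]ltNge imk mul0r mulr0.
- move=> z z1 z2; have [hz /andP[zt tz]] := h2 z z1 z2.
  rewrite (stepE _ hz) /chi kjp zt !mul1r he2 // (ltW zt) /=.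
  by move: tz; rewrite /t; lra.
Qed.

End necessity.

(** * Endpoints of the convex hull, and the conclusion *)

Lemma conv_hull_max (R : realType) (m : nat) (p : 'I_m.+1 -> R) q :
  conv_hull p q -> (forall i, p i <= q) -> exists i, p i = q.
Proof.
move=> [a [a01 a1] aq] hq.
have S0 : \sum_i a i * (q - p i) = 0.
  by under eq_bigr do rewrite mulrBr; rewrite sumrB -mulr_suml a1 aq mul1r subrr.
have P0 i : true -> 0 <= a i * (q - p i).
  by move=> _; have /andP[ai _] := a01 i; rewrite mulr_ge0 ?subr_ge0.
have Z i : a i * (q - p i) = 0.
  by apply: (psumr_eq0P _ S0) => // j _; exact: P0.
apply: contrapT => h.
suff : \sum_i a i = 0 by rewrite a1 => /eqP; rewrite oner_eq0.
apply: big1 => i _; move/eqP: (Z i); rewrite mulf_eq0 subr_eq0 => /orP[/eqP //|/eqP qi].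
by exfalso; apply: h; exists i.
Qed.

Lemma conv_hull_min (R : realType) (m : nat) (p : 'I_m.+1 -> R) q :
  conv_hull p q -> exists i, p i <= q.
Proof.
move=> [a [a01 a1] aq]; apply: contrapT => h.
have hq i : q < p i by rewrite ltNge; apply/negP => h'; apply: h; exists i.
have S0 : \sum_i a i * (p i - q) = 0.
  by under eq_bigr do rewrite mulrBr; rewrite sumrB -mulr_suml a1 aq mul1r subrr.
have P0 i : true -> 0 <= a i * (p i - q).
  by move=> _; have /andP[ai _] := a01 i; rewrite mulr_ge0 // subr_ge0 ltW.
have Z i : a i * (p i - q) = 0.
  by apply: (psumr_eq0P _ S0) => // j _; exact: P0.
suff : \sum_i a i = 0 by rewrite a1 => /eqP; rewrite oner_eq0.
apply: big1 => i _; move/eqP: (Z i); rewrite mulf_eq0 subr_eq0 => /orP[/eqP //|/eqP qi].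
by have := hq i; rewrite qi ltxx.
Qed.

Theorem proposition3p1 (R : realType) (m : nat)
    (p theta gamma : 'I_m.+1 -> R) (u : R -> R -> R) (Htilde : R -> R) :
  assumptionA1 p -> assumptionA2 p gamma -> assumptionA3 p theta gamma ->
  gradient_selection p theta gamma u ->
  locally_lipschitz Htilde ->
  (forall F : R -> R, lipschitz F ->
     (forall q, domJstar p gamma q -> (F q)%:E = H p theta gamma q) ->
     entropy_solution F (derive1 (J p gamma)) u)
  /\
  (entropy_solution Htilde (derive1 (J p gamma)) u <->
   exists C : R,
     (forall i, (Htilde (p i))%:E = (H p theta gamma (p i) + C%:E)%E) /\
     (forall q, conv_hull p q -> (H p theta gamma q + C%:E <= (Htilde q)%:E)%E)).
Proof.
move=> A1 A2 A3 hu lH.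
have Hn i := H_node i A1 A2 A3.
split=> [F lF hF|].
  have cF : continuous F.
    by apply: locally_lipschitz_continuous => x; exists setT => //; exact: filterT.
  apply: (@entropy_solution_step _ _ _ _ _ A1 F 0 u hu cF).
    move=> i; rewrite addr0; apply: EFin_inj; rewrite -Hn; apply: hF.
    exact: conv_hull_domJstar (conv_hull_node p i).
  by move=> q cq; rewrite adde0 hF //; exact: conv_hull_domJstar.
have cF := locally_lipschitz_continuous lH.
split=> [sol|[C [hC1 hC2]]]; last first.
  apply: (@entropy_solution_step _ _ _ _ _ A1 Htilde C u hu cF) => // i.
  by apply: EFin_inj; rewrite hC1 Hn.
exists (Htilde (p ord0) - theta ord0).
have hF := flux_nodes A1 A2 A3 hu cF sol.
split=> [i|q cq]; first by rewrite Hn hF.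
have [im imq] := conv_hull_min cq.
(* The level argument needs a slope strictly above [q]. The only other point of the hull is the
   largest slope, where the equality at nodes applies. *)
case: (pickP (fun i => q < p i)) => [jp qjp|nojp].
  exact: (flux_above A1 A2 A3 hu cF sol imq qjp).
have [|i <-] := conv_hull_max cq; first by move=> i; rewrite leNgt nojp.
by rewrite Hn -EFinD lee_fin -hF.
Qed.
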